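(* For $\delta,\rho\in(0,1)$ and a constant $c$ define $$\widetilde{\mathcal{U}}^{\rho}(\delta,\rho)=\sqrt{2\rho\log\left(\frac{1}{\delta^2\rho^3}\right)+c\rho},\qquad \widetilde{\mathcal{L}}^{\rho}(\delta,\rho)=\sqrt{2\rho\log\left(\frac{1}{\delta^2\rho^3}\right)+c\rho}.$$ Fix $\epsilon>0$ and $c>6$. For each $\delta\in(0,1)$ there exists $\rho_0>0$ such that the following holds. In the limit where $n/N\to\delta$, $k/n\to\rho\in(0,\rho_0)$ and $(\log n)/k\to0$ as $k\to\infty$, let each $n\times N$ matrix $A$ be sampled with i.i.d. entries from the Gaussian distribution $\mathcal{N}(0,1/n)$. Then $$\mathrm{Prob}\left(L(k,n,N;A)<(1+\epsilon)\,\widetilde{\mathcal{L}}^{\rho}(\delta,\rho)\right)\to1\quad\text{and}\quad \mathrm{Prob}\left(U(k,n,N;A)<(1+\epsilon)\,\widetilde{\mathcal{U}}^{\rho}(\delta,\rho)\right)\to1$$ exponentially in $k$.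
   Context: Let $\chi^N(k)$ denote the set of vectors in $\mathbb{R}^N$ with at most $k$ nonzero entries. The lower and upper restricted isometry constants of an $n\times N$ matrix $A$ are $$L(k,n,N;A):=1-\min_{x\in\chi^N(k),\,x\ne0}\frac{\|Ax\|_2^2}{\|x\|_2^2},\qquad U(k,n,N;A):=\max_{x\in\chi^N(k),\,x\ne0}\frac{\|Ax\|_2^2}{\|x\|_2^2}-1.$$ Limits are along sequences of positive integer triples $(k,n,N)$ with $k\le n\le N$. The superscript $\rho$ in $\widetilde{\mathcal{U}}^{\rho},\widetilde{\mathcal{L}}^{\rho}$ is only a label, not an exponent. $\log$ is the natural logarithm. ''A probability converges to $1$ exponentially in $k$'' means that one minus the probability is bounded by a function decaying exponentially to zero in $k$. *)

(* Defs.v *)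
From HB Require Import structures.
From mathcomp Require Import all_boot all_order all_algebra.
From mathcomp Require Import all_classical all_reals all_analysis.

Set Implicit Arguments.
Unset Strict Implicit.
Unset Printing Implicit Defensive.

Import Order.TTheory GRing.Theory Num.Theory.
Import numFieldNormedType.Exports.

Local Open Scope classical_set_scope.
Local Open Scope ring_scope.

Section restricted_isometry.
Context {R : realType}.

(* The library norm on matrices is the sup norm, hence this definition. *)
Definition l2norm (m : nat) (x : 'cV[R]_m) : R :=
  Num.sqrt (\sum_(i < m) x i 0 ^+ 2).

Definition nnz (N : nat) (x : 'cV[R]_N) : nat := #|[pred i | x i 0 != 0]|.

Definition sparse (N k : nat) : set 'cV[R]_N := [set x | (nnz x <= k)%N].

Definition isometry_ratio (n N : nat) (A : 'M[R]_(n, N)) (x : 'cV[R]_N) : R :=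
  l2norm (A *m x) ^+ 2 / l2norm x ^+ 2.

Definition sparse_ratios (k n N : nat) (A : 'M[R]_(n, N)) : set R :=
  [set isometry_ratio A x | x in [set x | sparse k x /\ x != 0]].

(* The infimum and the supremum are attained as soon as [0 < k] and [0 < N]:
   see [sparse_ratios_min] and [sparse_ratios_max]. *)
Definition RIC_L (k n N : nat) (A : 'M[R]_(n, N)) : R :=
  1 - inf (sparse_ratios k A).

Definition RIC_U (k n N : nat) (A : 'M[R]_(n, N)) : R :=
  sup (sparse_ratios k A) - 1.

Definition Utilde (c delta rho : R) : R :=
  Num.sqrt (2 * rho * ln (1 / (delta ^+ 2 * rho ^+ 3)) + c * rho).

Definition Ltilde (c delta rho : R) : R :=
  Num.sqrt (2 * rho * ln (1 / (delta ^+ 2 * rho ^+ 3)) + c * rho).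

Let l2norm_sqr m (x : 'cV[R]_m) : l2norm x ^+ 2 = \sum_(i < m) x i 0 ^+ 2.
Proof. by rewrite /l2norm sqr_sqrtr// sumr_ge0// => i _; exact: sqr_ge0. Qed.

Let l2norm_gt0 m (x : 'cV[R]_m) : x != 0 -> 0 < l2norm x.
Proof.
move=> x0; rewrite sqrtr_gt0.
have [i xi0] : exists i, x i 0 != 0.
  apply: contrapT => /forallNP h; move/eqP: x0; apply.
  by apply/colP => i; rewrite mxE; apply/eqP/negP => /negP /h.
rewrite (bigD1 i)//= ltr_pwDl ?exprn_even_gt0//.
by rewrite sumr_ge0// => j _; exact: sqr_ge0.
Qed.

Let sparse_sphere (N k : nat) : set 'rV[R]_N :=
  [set u | sparse k u^T /\ \sum_(i < N) u 0 i ^+ 2 = 1].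

Let quad (n N : nat) (A : 'M[R]_(n, N)) (u : 'rV[R]_N) : R :=
  \sum_(i < n) (\sum_(j < N) A i j * u 0 j) ^+ 2.

Let continuous_sum (S : topologicalType) (I : finType) (f : I -> S -> R) :
  (forall i, continuous (f i)) -> continuous (fun u => \sum_i f i u).
Proof.
move=> fc u; apply: cvg_big => [|i _]; first exact: add_continuous.
exact: fc.
Qed.

Let continuous_prod (S : topologicalType) (I : finType) (Q : pred I)
    (f : I -> S -> R) :
  (forall i, continuous (f i)) -> continuous (fun u => \prod_(i | Q i) f i u).
Proof.
move=> fc u; apply: cvg_big => [|i _]; first exact: mul_continuous.
exact: fc.
Qed.

Let continuous_sqr (S : topologicalType) (f : S -> R) :
  continuous f -> continuous (fun u => f u ^+ 2).
Proof.
by move=> fc u; under eq_fun do rewrite expr2; apply: cvgM; exact: fc.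
Qed.

Let continuous_scale (S : topologicalType) (a : R) (f : S -> R) :
  continuous f -> continuous (fun u => a * f u).
Proof. by move=> fc u; apply: cvgM; [exact: cvg_cst|exact: fc]. Qed.

Let quad_continuous n N (A : 'M[R]_(n, N)) : continuous (quad A).
Proof.
apply: (@continuous_sum _ _
  (fun i (u : 'rV[R]_N) => (\sum_(j < N) A i j * u 0 j) ^+ 2)) => i.
apply: (@continuous_sqr _ (fun u : 'rV[R]_N => \sum_(j < N) A i j * u 0 j)).
apply: (@continuous_sum _ _ (fun j (u : 'rV[R]_N) => A i j * u 0 j)) => j.
apply: (@continuous_scale _ _ (fun u : 'rV[R]_N => u 0 j)).
exact: coord_continuous.
Qed.

Let sum_sqr_continuous N : continuous (fun u : 'rV[R]_N => \sum_(j < N) u 0 j ^+ 2).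
Proof.
apply: (@continuous_sum _ _ (fun j (u : 'rV[R]_N) => u 0 j ^+ 2)) => j.
apply: (@continuous_sqr _ (fun u : 'rV[R]_N => u 0 j)).
exact: coord_continuous.
Qed.

Let sparse_prod N k (x : 'cV[R]_N) : sparse k x <->
  forall S : {set 'I_N}, (k < #|S|)%N -> \prod_(i in S) x i 0 = 0.
Proof.
split=> [xk S kS|h].
  apply/eqP; rewrite prodf_seq_eq0 -big_has.
  rewrite -[X in is_true X]negbK; apply/negP => hS.
  have : (#|S| <= nnz x)%N.
    apply: subset_leq_card; apply/fintype.subsetP => i iS; rewrite inE.
    apply/negP => xi0; move/negP: hS; apply.
    by rewrite big_has; apply/hasP; exists i; rewrite ?mem_index_enum// iS.
  by rewrite leqNgt (leq_ltn_trans xk kS).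
rewrite /sparse/= /nnz leqNgt; apply/negP => kx.
have := h [set i | x i 0 != 0]%SET.
rewrite cardsE => /(_ kx)/eqP; apply/negP.
by apply/prodf_neq0 => i; rewrite inE.
Qed.

Let sparse_sphere_closed N k : closed (@sparse_sphere N k).
Proof.
have -> : @sparse_sphere N k =
    \bigcap_(S in [set S : {set 'I_N} | (k < #|S|)%N])
      ((fun u : 'rV[R]_N => \prod_(i in S) u 0 i) @^-1` [set 0]) `&`
    (fun u : 'rV[R]_N => \sum_(i < N) u 0 i ^+ 2) @^-1` [set 1].
  apply/seteqP; split=> u /= [us u1]; split=> //.
    move=> S /= kS; move/sparse_prod : us => /(_ S kS) <-.
    by apply: eq_bigr => i _; rewrite mxE.
  apply/sparse_prod => S kS; rewrite -[RHS](us S kS).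
  by apply: eq_bigr => i _; rewrite mxE.
apply: closedI.
  apply: closed_bigI => S _; apply: preimage_closed; last exact: closed_eq.
  move=> u _; apply: (@continuous_prod _ _ _ (fun j (v : 'rV[R]_N) => v 0 j)).
  by move=> j; exact: coord_continuous.
apply: preimage_closed; last exact: closed_eq.
by move=> u _; exact: sum_sqr_continuous.
Qed.

Let sparse_sphere_bounded N k : bounded_set (@sparse_sphere N k).
Proof.
exists 1; split => // M M1 u [_ u1].
rewrite /= (le_trans _ (ltW M1))// [leLHS](_ : _ = mx_norm u)// mx_normrE.
apply: bigmax_le => // -[i j] _ /=.
rewrite ord1 -(@ler_pXn2r _ 2)// ?nnegrE// expr1n -normrX ger0_norm ?sqr_ge0//.
by rewrite -u1 (bigD1 j)//= lerDl sumr_ge0// => l _; exact: sqr_ge0.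
Qed.

Let sparse_sphere_compact N k : compact (@sparse_sphere N k).
Proof.
exact: bounded_closed_compact (@sparse_sphere_bounded N k)
  (@sparse_sphere_closed N k).
Qed.

Let sparse_sphere_neq0 N k : (0 < k)%N -> (0 < N)%N ->
  @sparse_sphere N k !=set0.
Proof.
case: N => // N k0 _; exists (delta_mx 0 0); split.
  rewrite /sparse/= (leq_trans _ k0)// -[leqRHS](card1 (0 : 'I_N.+1)).
  apply: subset_leq_card; apply/fintype.subsetP => i; rewrite !inE !mxE/=.
  by case: (i == 0) => //; rewrite /= ?andbF ?eqxx.
rewrite (bigD1 0)//= mxE !eqxx expr1n big1 ?addr0// => i i0.
by rewrite mxE (negbTE i0) andbF expr0n.
Qed.

Let quad_ratio n N (A : 'M[R]_(n, N)) (u : 'rV[R]_N) :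
  \sum_(i < N) u 0 i ^+ 2 = 1 -> isometry_ratio A u^T = quad A u.
Proof.
move=> u1; rewrite /isometry_ratio !l2norm_sqr.
under [X in _ / X]eq_bigr do rewrite mxE.
rewrite u1 divr1; apply: eq_bigr => i _; rewrite mxE; congr (_ ^+ 2).
by apply: eq_bigr => j _; rewrite mxE.
Qed.

Let sparse_ratiosE k n N (A : 'M[R]_(n, N)) :
  sparse_ratios k A = quad A @` @sparse_sphere N k.
Proof.
apply/seteqP; split=> y /=.
  move=> [x [xk x0] <-]; have nx := l2norm_gt0 x0.
  have sphere : \sum_(i < N) ((l2norm x)^-1 *: x)^T 0 i ^+ 2 = 1.
    under eq_bigr do rewrite !mxE exprMn.
    by rewrite -mulr_sumr -l2norm_sqr -exprMn mulVf ?expr1n// gt_eqF.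
  exists ((l2norm x)^-1 *: x)^T; first split => //.
    rewrite /sparse/= /nnz (leq_trans _ xk)//; apply: subset_leq_card.
    apply/fintype.subsetP => i; rewrite !inE trmxK mxE.
    by rewrite mulf_eq0 negb_or => /andP[].
  rewrite -quad_ratio// trmxK /isometry_ratio -scalemxAr !l2norm_sqr.
  under eq_bigr do rewrite mxE exprMn.
  under [X in _ / X]eq_bigr do rewrite mxE exprMn.
  rewrite -!mulr_sumr -mulf_div divff ?mul1r//.
  by rewrite expf_neq0// invr_neq0// gt_eqF.
move=> [u [uk u1] <-]; exists u^T; last exact: quad_ratio.
split=> //; apply/eqP => /(congr1 trmx); rewrite trmxK trmx0 => u0.
move: u1; rewrite u0 big1 => [/esym/eqP|i _]; first by rewrite oner_eq0.
by rewrite mxE expr0n.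
Qed.

Lemma sparse_ratios_min (k n N : nat) (A : 'M[R]_(n, N)) :
  (0 < k)%N -> (0 < N)%N ->
  sparse_ratios k A (inf (sparse_ratios k A)) /\
  lbound (sparse_ratios k A) (inf (sparse_ratios k A)).
Proof.
move=> k0 N0; rewrite sparse_ratiosE.
have [c /set_mem cS cmin] := EVT_min_rV (sparse_sphere_neq0 k0 N0)
  (@sparse_sphere_compact N k) (continuous_subspaceT (@quad_continuous n N A)).
have lbc : lbound (quad A @` @sparse_sphere N k) (quad A c).
  by move=> _ [u /mem_set uS <-]; exact: cmin.
suff -> : inf (quad A @` @sparse_sphere N k) = quad A c by split; [exists c|].
apply/eqP; rewrite eq_le; apply/andP; split.
  by apply: ge_inf; [exists (quad A c)|exists c].
by apply: lb_le_inf => //; exists (quad A c), c.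
Qed.

Lemma sparse_ratios_max (k n N : nat) (A : 'M[R]_(n, N)) :
  (0 < k)%N -> (0 < N)%N ->
  sparse_ratios k A (sup (sparse_ratios k A)) /\
  ubound (sparse_ratios k A) (sup (sparse_ratios k A)).
Proof.
move=> k0 N0; rewrite sparse_ratiosE.
have [c /set_mem cS cmax] := EVT_max_rV (sparse_sphere_neq0 k0 N0)
  (@sparse_sphere_compact N k) (continuous_subspaceT (@quad_continuous n N A)).
have ubc : ubound (quad A @` @sparse_sphere N k) (quad A c).
  by move=> _ [u /mem_set uS <-]; exact: cmax.
suff -> : sup (quad A @` @sparse_sphere N k) = quad A c by split; [exists c|].
apply/eqP; rewrite eq_le; apply/andP; split.
  by apply: ge_sup => //; exists (quad A c), c.
by apply: ub_le_sup; [exists (quad A c)|exists c].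
Qed.

End restricted_isometry.

Section gaussian.
Context {R : realType} {d : measure_display} {T : measurableType d}
  (P : probability T R).

Definition mutually_independent (I : finType) (X : I -> {RV P >-> R}) : Prop :=
  forall (J : {set I}) (B : I -> set R),
    (forall i, i \in J -> measurable (B i)) ->
    P (\bigcap_(i in [set` J]) (X i @^-1` B i)) =
    (\prod_(i in J) P (X i @^-1` B i))%E.

(* [normal_prob] takes the standard deviation: the variance here is [1 / n]. *)
Definition gaussian_matrix (n N : nat) (X : 'I_n -> 'I_N -> {RV P >-> R}) : Prop :=
  mutually_independent (fun p : 'I_n * 'I_N => X p.1 p.2) /\
  forall i j (B : set R), measurable B ->
    distribution P (X i j) B = normal_prob 0 (Num.sqrt (1 / n%:R)) B.

Definition random_matrix (n N : nat) (X : 'I_n -> 'I_N -> {RV P >-> R}) (w : T) :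
  'M[R]_(n, N) := \matrix_(i, j) X i j w.

End gaussian.

(* For [p t] in [0, 1] and [k] tending to infinity, this entails the
   convergence of [p] to 1. *)
Definition tends_to_1_exponentially (R : realType) (k : nat -> nat)
    (p : nat -> \bar R) : Prop :=
  exists C alpha : R, 0 < alpha /\
    forall t, (1 - p t <= (C * expR (- (alpha * (k t)%:R)))%:E)%E.

(* Main.v *)
Require Import Defs.
From HB Require Import structures.
From mathcomp Require Import all_boot all_order all_algebra.
From mathcomp Require Import all_classical all_reals all_analysis.
From mathcomp Require Import measurable_realfun.
From mathcomp Require Import ring lra.

Set Implicit Arguments.
Unset Strict Implicit.
Unset Printing Implicit Defensive.

Import Order.TTheory GRing.Theory Num.Theory.
Import numFieldNormedType.Exports.

Local Open Scope classical_set_scope.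
Local Open Scope ring_scope.

(** Write q(x) = |A x|^2 - |x|^2 for the distortion of a vector.  For a sparse
unit vector, q(x) lies between -L and U, and the larger of L and U equals |q(u)|
for some sparse unit vector u.  The theorem is a union bound for |q| over a
finite net of sparse vectors.

Concentration at one vector.  For fixed x, the coordinates of A x are
independent centred Gaussians of variance |x|^2 / n, so
  E exp(- mu n |A x|^2) = (1 + 2 mu |x|^2)^(- n / 2)
for mu of either sign with 1 + 2 mu |x|^2 > 0 ([gaussian_matrix_mgf]).  This is obtained without
identifying the law of A x: the entries of A are integrated out one at a time,
and completing the square turns exp(- mu (z + a X)^2) into a multiple of
exp(- mu' z^2).  Markov's inequality then bounds each tail P(q(x) >= y) and
P(q(x) <= - y) by exp(- (5/22) n y^2) for small y and |x| <= 1
([distortion_tail]); the sharp constant for y tending to 0 is 1/4.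

Net.  For a support S of size k, the net consists of the vectors
z / (m sqrt k), with z an integer vector supported in S and |z|^2 <= m^2 k.
There are at most (4 * 2^(m^2))^k of them ([card_lattice_net]), and truncating
the coordinates of m sqrt k u towards 0 gives a net vector at distance at most
1/m from the unit vector u ([lattice_net_approx]).  Since q is a quadratic form
bounded by D = max L U on sparse unit vectors, it is Lipschitz with constant 2 D
on the ball of vectors supported in S, hence D (1 - 2/m) is at most the maximum
of |q| over the net ([RIC_le_lattice_net]).

Balance.  There are 'C(N, k) <= exp(k (1 + ln(N/k))) supports.  With
x^2 = rho (4 ln(1/delta) + 6 ln(1/rho) + c) and y = (1 - 2/m) x, the failure
probability is at most 2 exp(k g), where g tends to
  1 + ln(4 * 2^(m^2)) + ln(1/delta) + ln(1/rho) - (5/22) y^2 / rho.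
For m = 20, the coefficient of ln(1/rho) is 1 - (5/22) (9/10)^2 6 < 0, so this
limit is negative as soon as rho is small enough in terms of delta and c
([small_rho_bounds]).

The events of the theorem are measurable because, by homogeneity and continuity
of q, it suffices to test the inequalities q(x) <= b |x|^2 and - q(x) <= b |x|^2
on integer vectors ([distortion_le_int]). *)

(** * Independence from the variables already integrated out *)
Section independent_past.
Context {R : realType} {d : measure_display} {T : measurableType d}
  (P : probability T R) (I : finType) (X : I -> {RV P >-> R}).
Hypothesis X_indep : mutually_independent X.

Definition cylinders (J : {set I}) : set (set T) :=
  [set E | exists2 B : I -> set R, (forall i, i \in J -> measurable (B i)) &
           E = \bigcap_(i in [set` J]) (X i @^-1` B i)].

(** The sigma-algebra of the variables indexed by [J], as a measurable type on the
sample space, so that a function of these variables is a measurable function on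
[past J]. *)
Definition past (J : {set I}) : measurableType (cylinders J).-sigma :=
  g_sigma_algebraType (cylinders J).

Lemma cylinders_setI (J : {set I}) : setI_closed (cylinders J).
Proof.
move=> _ _ [B mB ->] [C mC ->].
exists (fun i => B i `&` C i) => [i iJ|]; first exact: measurableI (mB i iJ) (mC i iJ).
by rewrite -bigcapI.
Qed.

Lemma measurable_RV_preimage (i : I) (B : set R) :
  measurable B -> measurable (X i @^-1` B).
Proof. by move=> mB; rewrite -[X in measurable X]setTI; exact: measurable_funPT. Qed.

Lemma past_measurable (J : {set I}) (E : set (past J)) :
  measurable E -> measurable (E : set T).
Proof.
move=> mE; apply: (smallest_sub _ _ mE); first exact: sigma_algebra_measurable.
move=> _ [B mB ->]; apply: fin_bigcap_measurable; first exact: finite_finset.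
by move=> i /= iJ; apply: measurable_RV_preimage; exact: mB.
Qed.

(** Cylinders over [J] form a pi-system, on which the product formula is mutual
independence for the index set [q |: J]; the sets satisfying it form a
lambda-system. *)
Lemma past_indep (J : {set I}) (q : I) (B : set R) (E : set (past J)) :
  q \notin J -> measurable B -> measurable E ->
  P (E `&` X q @^-1` B) = (P E * P (X q @^-1` B))%E.
Proof.
move=> qJ mB mE.
have mqB := measurable_RV_preimage q mB.
pose H : set (set T) := [set E | measurable E /\
  P (E `&` X q @^-1` B) = (P E * P (X q @^-1` B))%E].
suff : <<s cylinders J>> `<=` H by move=> /(_ _ mE)[].
apply: (lambda_system_subset (@cylinders_setI J) (D := setT)) => //.
- apply/dynkin_lambda_system; split.
  + by split => //; rewrite setTI probability_setT mul1e.
  + move=> A [mA PA]; split; first exact: measurableC.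
    have -> : P (~` A `&` X q @^-1` B) =
        (P (X q @^-1` B) - P A * P (X q @^-1` B))%E.
      rewrite setIC -setDE measureD//; last by rewrite ltey_eq fin_num_measure.
      by rewrite -PA setIC.
    rewrite probability_setC// muleBl ?mul1e// ?fin_num_measure//.
  + move=> F tF HF; have mF i : measurable (F i) := (HF i).1.
    split; first exact: bigcup_measurable.
    rewrite setI_bigcupl measure_bigcup//; last first.
    * by apply: trivIset_setIr.
    * by move=> i _; exact: measurableI.
    rewrite measure_bigcup//; move: HF; rewrite -[P (X q @^-1` B)]fineK ?fin_num_measure//.
    move=> HF; rewrite muleC -nneseriesZl//.
    by apply: eq_eseriesr => i _; rewrite muleC fineK ?fin_num_measure//; exact: (HF i).2.
- move=> _ [C mC ->].
  have CE : \bigcap_(i in [set` J]) X i @^-1` C i =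
      \bigcap_(i in [set` J]) X i @^-1` (if i == q then B else C i).
    apply: eq_bigcapr => i /= iJ; case: eqP => // iq.
    by move: qJ; rewrite -iq iJ.
  split.
    apply: fin_bigcap_measurable; first exact: finite_finset.
    by move=> i /= iJ; apply: measurable_RV_preimage; exact: mC.
  have setU1E (F : I -> set T) : \bigcap_(i in [set` q |: J]) F i =
      \bigcap_(i in [set` J]) F i `&` F q.
    rewrite setIC -bigcap_setU1; congr bigcap; apply/seteqP.
    split=> i /=; rewrite !inE; first by case/orP=> [/eqP|]; tauto.
    by move=> [->|->]; rewrite ?eqxx ?orbT.
  rewrite CE -[X q @^-1` B](_ : X q @^-1` (if q == q then B else C q) = _); last first.
    by rewrite eqxx.
  rewrite -(setU1E (fun i => X i @^-1` (if i == q then B else C i))).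
  have mD (i : I) : i \in q |: J -> measurable (if i == q then B else C i).
    by rewrite !inE; case: eqP => //= _; exact: mC.
  rewrite (X_indep mD) big_setU1//= muleC; congr (_ * _)%E.
  by rewrite X_indep// => i iJ; apply: mD; rewrite inE iJ orbT.
Qed.


(** The joint law of the past and [X q] is a product measure, so Tonelli's theorem
allows [X q] to be integrated first, the past being frozen. *)
Lemma past_law_indep (J : {set I}) (q : I) (h : past J * R -> \bar R) :
  q \notin J -> measurable_fun setT h -> (forall z, 0 <= h z)%E ->
  (\int[P]_w h (w, X q w) =
   \int[P]_w \int[distribution P (X q)]_x h (w, x))%E.
Proof.
move=> qJ mh h0.
pose toPast (w : T) : past J := w.
have mid : measurable_fun setT toPast.
  by move=> _ E mE; rewrite setTI; exact: past_measurable mE.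
pose phi (w : T) : past J * R := (toPast w, X q w).
have mphi : measurable_fun setT phi by apply: measurable_fun_pair.
pose toPastM : {mfun T >-> past J} :=
  HB.pack toPast (isMeasurableFun.Build _ _ _ _ _ mid).
pose phiM : {mfun T >-> (past J * R)%type} :=
  HB.pack phi (isMeasurableFun.Build _ _ _ _ _ mphi).
have lawE B : measurable B -> (distribution P toPastM \x distribution P (X q))%E B =
    distribution P phiM B.
  apply: product_measure_unique => A C mA mC.
  rewrite /distribution/= /pushforward/=.
  exact: (past_indep qJ mC mA).
transitivity (\int[distribution P phiM]_z h z)%E.
  rewrite ge0_integral_pushforward//; by [].
rewrite (eq_measure_integral (distribution P toPastM \x distribution P (X q))%E); last first.
  by move=> A mA _; apply/esym; exact: lawE.
rewrite fubini_tonelli1//.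
rewrite ge0_integral_pushforward//.
  exact: measurable_fun_fubini_tonelli_F.
by move=> w _; apply: integral_ge0.
Qed.

Lemma measurable_past (J : {set I}) (i : I) : i \in J ->
  measurable_fun [set: past J] (X i : past J -> R).
Proof.
move=> iJ _ B mB; rewrite setTI; apply: sub_sigma_algebra.
exists (fun j => if j == i then B else setT); first by move=> j _; case: ifP.
apply/seteqP; split=> w /=.
  by move=> XB j /= _; case: eqP => // ->.
by move=> /(_ i iJ); rewrite /= eqxx.
Qed.

End independent_past.

(** * Exponential moments of squared Gaussian sums *)
Section gaussian_mgf.
Context {R : realType}.

(** The density is identified with the Radon-Nikodym derivative almost everywhere,
by comparing their integrals over measurable sets. *)
Lemma ge0_integral_normal_prob (m s : R) (f : R -> \bar R) :
  measurable_fun setT f -> (forall x, 0 <= f x)%E ->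
  (\int[normal_prob m s]_x f x =
   \int[lebesgue_measure]_x (f x * (normal_pdf m s x)%:E))%E.
Proof.
move=> mf f0.
have dom := @normal_prob_dominates R m s.
rewrite -(Radon_Nikodym_SigmaFinite.change_of_variables dom)//.
apply: ae_eq_integral => //.
- apply: emeasurable_funM => //; apply: measurable_int.
  exact: Radon_Nikodym_SigmaFinite.f_integrable.
- apply: emeasurable_funM => //; apply/measurable_EFinP.
  exact: measurable_normal_pdf.
- apply: ae_eqe_mul2l; apply: integral_ae_eq => //.
  + exact: Radon_Nikodym_SigmaFinite.f_integrable.
  + by apply/measurable_EFinP; exact: measurable_normal_pdf.
  + by move=> E _ mE; rewrite -Radon_Nikodym_SigmaFinite.f_integral.
Qed.

Lemma complete_square (mu a s z x : R) (k := 1 + 2 * mu * (a ^+ 2 * s ^+ 2)) :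
  s != 0 -> k != 0 ->
  - (mu * (z + a * x) ^+ 2) + - (x - 0) ^+ 2 / (s ^+ 2 *+ 2) =
  - (mu / k * z ^+ 2) +
  - (x - - (2 * s ^+ 2 * mu * a * z / k)) ^+ 2 / (s ^+ 2 / k *+ 2).
Proof.
by move=> s0; rewrite /k => k0; field; rewrite s0 andbT exprMn.
Qed.

(** By [complete_square], the integrand times the density of variance [s ^+ 2] is
an explicit multiple of the normal density of variance [s ^+ 2 / k], where
[k = 1 + 2 * mu * a ^+ 2 * s ^+ 2].  Positivity of [k] is the only constraint on
[mu], so that one computation serves both the upper and the lower tail. *)
Lemma gaussian_square_step (mu a s z : R) : s != 0 -> 0 < 1 + 2 * mu * (a ^+ 2 * s ^+ 2) ->
  (\int[normal_prob 0 s]_x (expR (- (mu * (z + a * x) ^+ 2)))%:E =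
   ((Num.sqrt (1 + 2 * mu * (a ^+ 2 * s ^+ 2)))^-1 *
    expR (- (mu / (1 + 2 * mu * (a ^+ 2 * s ^+ 2)) * z ^+ 2)))%:E)%E.
Proof.
move=> s0 k0; set k := 1 + _ in k0 *.
have kn0 : k != 0 by rewrite gt_eqF.
have sk0 : 0 < Num.sqrt k by rewrite sqrtr_gt0.
have skn0 : Num.sqrt k != 0 by rewrite gt_eqF.
have sk2 : Num.sqrt k ^+ 2 = k by rewrite sqr_sqrtr// ltW.
rewrite ge0_integral_normal_prob//; first last.
  apply/measurable_EFinP; apply: measurableT_comp => //.
  apply: measurableT_comp => //; apply: measurable_funM => //.
  by apply: measurable_funX; apply: measurable_funD => //; exact: measurable_funM.
pose m := - (2 * s ^+ 2 * mu * a * z / k).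
have s'0 : s / Num.sqrt k != 0 by rewrite mulf_neq0// invr_neq0.
under eq_integral => x _.
  rewrite -EFinM [X in X%:E](_ : _ = ((Num.sqrt k)^-1 * expR (- (mu / k * z ^+ 2))) *
      normal_pdf m (s / Num.sqrt k) x); last first.
    rewrite !normal_pdfE//.
    have -> : normal_peak (s / Num.sqrt k) = Num.sqrt k * normal_peak s.
      rewrite /normal_peak exprMn exprVn sk2 -mulrA (mulrC _ pi) mulrA -mulrnAl.
      have w0 : 0 <= s ^+ 2 * pi *+ 2 by rewrite mulrn_wge0// mulr_ge0 ?pi_ge0 ?sqr_ge0.
      rewrite (sqrtrM _ w0) sqrtrV ?(ltW k0)//.
      by rewrite invfM invrK mulrC.
    rewrite /normal_fun.
    rewrite [RHS](_ : _ = normal_peak s * (expR (- (mu / k * z ^+ 2)) *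
       expR (- (x - m) ^+ 2 / ((s / Num.sqrt k) ^+ 2 *+ 2)))); last by field.
    rewrite [LHS]mulrCA -!expRD; congr (_ * expR _).
    rewrite exprMn exprVn sk2 /m.
    exact: complete_square.
  over.
rewrite /=.
rewrite (_ : (fun x => _) =
    fun x => ((Num.sqrt k)^-1 * expR (- (mu / k * z ^+ 2)))%:E *
      (normal_pdf m (s / Num.sqrt k) x)%:E)%E; last first.
  by apply/funext => x; rewrite EFinM.
rewrite ge0_integralZl//.
- by rewrite integral_normal_pdf mule1.
- by apply/measurable_EFinP; exact: measurable_normal_pdf.
- by move=> x _; rewrite lee_fin normal_pdf_ge0.
Qed.
End gaussian_mgf.

Section independent_gaussians.
Context {R : realType} {d : measure_display} {T : measurableType d}
  (P : probability T R) (I : finType) (X : I -> {RV P >-> R}) (s : R).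
Hypothesis X_indep : mutually_independent X.
Hypothesis X_normal : forall i (B : set R), measurable B ->
  distribution P (X i) B = normal_prob 0 s B.
Hypothesis s0 : s != 0.

(** The law of [X q] and [normal_prob] live on two copies of the real line with
convertible sigma-algebras but different displays; the law is transported to the
second copy before the measures are compared. *)
Lemma ge0_integral_distribution_normal (q : I) (f : R -> \bar R) :
  measurable_fun setT f -> (forall x, 0 <= f x)%E ->
  (\int[distribution P (X q)]_x f x = \int[normal_prob 0 s]_x f x)%E.
Proof.
move=> mf f0; rewrite ge0_integral_pushforward//.
pose Y : T -> measurableTypeR R := X q.
have mY : measurable_fun setT Y.
  by move=> _ B mB; apply: (measurable_funPT (X q)).
rewrite preimage_setT -[LHS](@ge0_integral_pushforward _ _ _ _ _ Y mY P setT f)//.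
pose YM : {mfun T >-> measurableTypeR R} := HB.pack Y (isMeasurableFun.Build _ _ _ _ _ mY).
transitivity (\int[distribution P YM]_x f x)%E; first by [].
by apply: eq_measure_integral => A mA _; exact: X_normal.
Qed.

(** One step of the integration: a fresh variable disappears from the squared sum,
at the price of a constant factor and of a change of [mu].  The weight [W]
carries the rows that are still to be integrated. *)
Lemma peel_gaussian (J : {set I}) (q : I) (W Z : past X J -> R) (mu a : R) :
  q \notin J -> measurable_fun setT W -> measurable_fun setT Z ->
  (forall w, 0 <= W w) -> 0 < 1 + 2 * mu * (a ^+ 2 * s ^+ 2) ->
  (\int[P]_w (W w * expR (- (mu * (Z w + a * X q w) ^+ 2)))%:E =
   (Num.sqrt (1 + 2 * mu * (a ^+ 2 * s ^+ 2)))^-1%:E *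
   \int[P]_w (W w * expR (- (mu / (1 + 2 * mu * (a ^+ 2 * s ^+ 2)) * Z w ^+ 2)))%:E)%E.
Proof.
move=> qJ mW mZ W0 k0; set k := 1 + _ in k0 *.
pose h (z : (past X J * R)%type) : \bar R :=
  (W z.1 * expR (- (mu * (Z z.1 + a * z.2) ^+ 2)))%:E.
have mh : measurable_fun setT h.
  apply/measurable_EFinP; apply: measurable_funM.
    exact: (measurableT_comp mW measurable_fst).
  apply: measurableT_comp => //; apply: measurableT_comp => //.
  apply: measurable_funM => //; apply: measurable_funX; apply: measurable_funD.
    exact: (measurableT_comp mZ measurable_fst).
  by apply: measurable_funM => //; exact: measurable_snd.
have h0 z : (0 <= h z)%E by rewrite lee_fin mulr_ge0 ?expR_ge0.
rewrite (past_law_indep X_indep qJ mh h0).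
have inner w : (\int[distribution P (X q)]_x h (w, x) =
    (Num.sqrt k)^-1%:E * (W w * expR (- (mu / k * Z w ^+ 2)))%:E)%E.
  rewrite ge0_integral_distribution_normal//; last exact: measurable_fun_pair2.
  rewrite /h /=; under eq_integral do rewrite EFinM.
  rewrite ge0_integralZl//.
  - by rewrite gaussian_square_step// -!EFinM; congr _%:E; rewrite mulrCA.
  - apply/measurable_EFinP; apply: measurableT_comp => //.
    apply: measurableT_comp => //; apply: measurable_funM => //.
    by apply: measurable_funX; apply: measurable_funD => //; exact: measurable_funM.
  - by rewrite lee_fin.
under eq_integral do rewrite inner.
have mT (f : past X J -> R) : measurable_fun setT f ->
    measurable_fun [set: T] (f : T -> R).
  move=> mf _ B mB; rewrite setTI; apply: past_measurable.
  by rewrite -[X in measurable X]setTI; exact: mf.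
rewrite ge0_integralZl//.
- apply/measurable_EFinP; apply: measurable_funM; first exact: mT.
  apply: measurableT_comp => //; apply: measurableT_comp => //.
  by apply: measurable_funM => //; apply: measurable_funX; exact: mT.
- by move=> w _; rewrite lee_fin mulr_ge0 ?expR_ge0.
Qed.

Lemma measurable_past_subset (J K : {set I}) (W : T -> R) : J \subset K ->
  measurable_fun [set: past X J] W -> measurable_fun [set: past X K] W.
Proof.
move=> /fintype.subsetP JK mW _ B mB; rewrite setTI.
have : <<s cylinders X J>> (W @^-1` B).
  by rewrite -[X in _ X]setTI; exact: mW.
move: (W @^-1` B); apply: smallest_sub; first exact: smallest_sigma_algebra.
move=> _ [C mC ->]; apply: sub_sigma_algebra.
exists (fun i => if i \in J then C i else setT).
  by move=> i _; case: ifP => // iJ; exact: mC.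
apply/seteqP; split=> w /= Cw i /= iJ.
  by case: ifP => // iJ'; exact: Cw.
by have := Cw i (JK _ iJ); rewrite /= iJ.
Qed.

Lemma measurable_past_sum (K : {set I}) (r : seq I) (u : I -> R) :
  {subset r <= K} ->
  measurable_fun [set: past X K] (fun w => \sum_(j <- r) u j * X j w).
Proof.
elim: r => [|j r IH] rK.
  by rewrite (_ : (fun _ => _) = cst 0)//; apply/funext => w; rewrite big_nil.
rewrite (_ : (fun _ => _) =
    (fun w => u j * X j w + \sum_(i <- r) u i * X i w)); last first.
  by apply/funext => w; rewrite big_cons.
apply: measurable_funD.
  by apply: measurable_funM => //; apply: measurable_past; rewrite rK ?mem_head.
by apply: IH => i ir; rewrite rK// inE ir orbT.
Qed.

(** Peeling off all the variables of a row: the successive factors [1 + 2 mu a^2 s^2]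
telescope, so only the sum of the squared coefficients remains. *)
Lemma gaussian_square_mgf_past (r : seq I) (J : {set I}) (W : T -> R)
    (mu : R) (u : I -> R) :
  uniq r -> {in r, forall i, i \notin J} ->
  measurable_fun [set: past X J] W -> (forall w, 0 <= W w) ->
  0 < 1 + 2 * mu * s ^+ 2 * \sum_(j <- r) u j ^+ 2 ->
  (\int[P]_w (W w * expR (- (mu * (\sum_(j <- r) u j * X j w) ^+ 2)))%:E =
   (Num.sqrt (1 + 2 * mu * s ^+ 2 * \sum_(j <- r) u j ^+ 2))^-1%:E *
   \int[P]_w (W w)%:E)%E.
Proof.
elim: r mu => [|q r IH] mu /= rU rJ mW W0 pos.
  rewrite big_nil mulr0 addr0 sqrtr1 invr1 mul1e.
  by apply: eq_integral => w _; rewrite big_nil expr0n/= mulr0 oppr0 expR0 mulr1.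
move: rU => /andP[qr rU]; move: pos; rewrite big_cons.
set S := \sum_(j <- r) _ => pos.
have S0 : 0 <= S by apply: sumr_ge0 => i _; exact: sqr_ge0.
have s20 : 0 <= s ^+ 2 := sqr_ge0 s.
have u20 : 0 <= u q ^+ 2 := sqr_ge0 _.
set k := 1 + 2 * mu * (u q ^+ 2 * s ^+ 2).
(* For negative [mu], the partial sum of squares is at most the full one. *)
have k0 : 0 < k.
  rewrite /k; have [mu0|mu0] := leP 0 mu.
    by have := mulr_ge0 mu0 (mulr_ge0 u20 s20); lra.
  have mu'0 : 0 <= - mu by rewrite oppr_ge0 ltW.
  have := mulr_ge0 mu'0 (mulr_ge0 s20 S0); move: pos; lra.
pose K := J :|: [set i | i \in r]%SET.
have qK : q \notin K by rewrite !inE negb_or qr rJ ?mem_head.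
under eq_integral do rewrite big_cons addrC.
have pK := @peel_gaussian K q W (fun w => \sum_(j <- r) u j * X j w) mu (u q) qK.
rewrite pK//.
- have kE : 1 + 2 * (mu / k) * s ^+ 2 * S = (1 + 2 * mu * s ^+ 2 * (u q ^+ 2 + S)) / k.
    by move: (lt0r_neq0 k0); rewrite /k => kn0; field; rewrite exprMn.
  rewrite IH//.
  + rewrite muleA -EFinM; congr (_%:E * _)%E.
    rewrite kE -/k sqrtrM ?(ltW pos)// sqrtrV ?(ltW k0)// invfM invrK mulrCA.
    by rewrite mulVf ?mulr1// gt_eqF// sqrtr_gt0.
  + by move=> i ir; rewrite rJ// inE ir orbT.
  + by rewrite kE divr_gt0.
- by apply: measurable_past_subset mW; exact: finset.subsetUl.
- by apply: measurable_past_sum => i ir; rewrite !inE ir orbT.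
Qed.


(** Rows use disjoint sets of variables, so they are integrated one after the other,
the exponential of the remaining rows serving as weight. *)
Lemma gaussian_squares_mgf (rows : finType) (cols : rows -> seq I)
    (mu : R) (u : I -> R) (S : R) :
  (forall i, uniq (cols i)) ->
  (forall i i' p, p \in cols i -> p \in cols i' -> i = i') ->
  (forall i, \sum_(p <- cols i) u p ^+ 2 = S) ->
  0 < 1 + 2 * mu * s ^+ 2 * S ->
  (\int[P]_w (expR (- (mu * \sum_i (\sum_(p <- cols i) u p * X p w) ^+ 2)))%:E =
   ((Num.sqrt (1 + 2 * mu * s ^+ 2 * S))^-1 ^+ #|rows|)%:E)%E.
Proof.
move=> cU cdisj uS pos.
pose Y i w := (\sum_(p <- cols i) u p * X p w) ^+ 2.
pose past_of (r : seq rows) := [set p | has (fun i => p \in cols i) r]%SET.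
suff main (r : seq rows) : uniq r ->
    measurable_fun [set: past X (past_of r)]
      (fun w => expR (- (mu * \sum_(i <- r) Y i w))) /\
    (\int[P]_w (expR (- (mu * \sum_(i <- r) Y i w)))%:E =
      ((Num.sqrt (1 + 2 * mu * s ^+ 2 * S))^-1 ^+ size r)%:E)%E.
  have [_] := main (index_enum rows) (index_enum_uniq rows).
  have -> : size (index_enum rows) = #|rows|.
    by rewrite -sum1_size -sum1_card; apply: eq_bigl.
  by [].
elim: r => [|i r IH] /=.
  move=> _; split.
    by rewrite (_ : (fun _ => _) = cst 1)//; apply/funext => w;
      rewrite big_nil mulr0 oppr0 expR0.
  under eq_integral do rewrite big_nil mulr0 oppr0 expR0.
  transitivity (1 * P setT)%E; first exact: (integral_cst P measurableT 1).
  by rewrite probability_setT mule1.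
move=> /andP[ir rU]; have [mr Er] := IH rU.
pose W w := expR (- (mu * \sum_(i <- r) Y i w)).
have consE w : expR (- (mu * \sum_(j <- i :: r) Y j w)) =
    W w * expR (- (mu * (\sum_(p <- cols i) u p * X p w) ^+ 2)).
  by rewrite big_cons mulrDr opprD addrC expRD.
split.
  rewrite (_ : (fun _ => _) = fun w => W w *
      expR (- (mu * (\sum_(p <- cols i) u p * X p w) ^+ 2))); last first.
    by apply/funext => w; exact: consE.
  apply: measurable_funM.
    apply: measurable_past_subset mr; apply/fintype.subsetP => p.
    by rewrite !inE /= => ->; rewrite orbT.
  apply: measurableT_comp => //; apply: measurableT_comp => //.
  apply: measurable_funM => //; apply: measurable_funX.
  by apply: measurable_past_sum => p pi; rewrite inE /= pi.
under eq_integral do rewrite consE.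
rewrite (@gaussian_square_mgf_past _ (past_of r)) ?uS//.
- by rewrite Er -EFinM -exprS.
- move=> p pi; rewrite inE; apply/hasPn => j jr; apply/negP => pj.
  by move: ir; rewrite (cdisj _ _ _ pi pj) jr.
- by move=> w; exact: expR_ge0.
Qed.

End independent_gaussians.

(** * Concentration of the squared norm of the image of a fixed vector *)
Section tails.
Context {R : realType}.

(** A weak form of ln (1 + s) >= s - s^2 / 2 + O(s^3): enlarging 1/2 to 11/20 absorbs
the cubic term.  The derivative of (1 + s) exp(- s + (11/20) s^2) has the sign of
s (1/10 + (11/10) s), hence the range [- 1/11 <= s]. *)
Lemma expR_quadratic_le1Dx (s : R) : - (1/11) <= s ->
  expR (s - 11/20 * s ^+ 2) <= 1 + s.
Proof.
move=> s11.
pose g (t : R) : R := (1 + t) * expR (- t + 11/20 * t ^+ 2).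
pose dg (t : R) : R := t * (1/10 + 11/10 * t) * expR (- t + 11/20 * t ^+ 2).
have dgE (t : R) : is_derive t 1 g (dg t).
  rewrite /g; apply: is_derive_eq.
  transitivity ((1 + t) * (expR (- t + 11/20 * t ^+ 2) * (- 1 + 11/20 * (t * 1 + t * 1)))
    + expR (- t + 11/20 * t ^+ 2) * (0 + 1)); first by [].
  by rewrite /dg; field.
have cg (a b : R) : {within `[a, b], continuous g}.
  apply: continuous_subspaceT => t; apply/differentiable_continuous/derivable1_diffP.
  by have := dgE t; case.
have g0 : g 0 = 1 by rewrite /g oppr0 expr0n mulr0 !addr0 expR0 mulr1.
suff : 1 <= g s.
  rewrite /g => h; rewrite -[_ - _]opprK expRN opprB addrC.
  by rewrite -[leLHS]mul1r ler_pdivrMr ?expR_gt0.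
rewrite -g0 -subr_ge0; have [s0|s0|->] := ltgtP s 0; last by rewrite subrr.
- have [c /[!in_itv]/= /andP[sc c0]] := MVT s0 (fun x _ => dgE x) (cg s 0).
  move=> /eqP; rewrite -eqr_opp opprB => /eqP ->.
  rewrite -mulrN; rewrite mulr_le0//; last lra.
  rewrite /dg -mulrA mulr_le0_ge0 ?(ltW c0)// mulr_ge0 ?expR_ge0//.
  lra.
- have [c /[!in_itv]/= /andP[sc c0]] := MVT s0 (fun x _ => dgE x) (cg 0 s).
  move=> ->; rewrite subr0 mulr_ge0 ?(ltW s0)// /dg !mulr_ge0 ?expR_ge0 ?(ltW sc)//.
  lra.
Qed.


Definition sqnorm m (x : 'cV[R]_m) : R := \sum_(i < m) x i 0 ^+ 2.

Lemma sqnorm_ge0 m (x : 'cV[R]_m) : 0 <= sqnorm x.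
Proof. by apply: sumr_ge0 => i _; exact: sqr_ge0. Qed.

Definition distortion n N (A : 'M[R]_(n, N)) (x : 'cV[R]_N) : R :=
  sqnorm (A *m x) - sqnorm x.

Section gaussian.
Context {d : measure_display} {T : measurableType d} (P : probability T R).
Context (n N : nat) (X : 'I_n -> 'I_N -> {RV P >-> R}).

Lemma sqnorm_random_matrix (u : 'cV[R]_N) w :
  sqnorm (random_matrix X w *m u) =
  \sum_(i < n) (\sum_(j < N) u j 0 * X i j w) ^+ 2.
Proof.
apply: eq_bigr => i _; rewrite mxE; congr (_ ^+ 2).
by apply: eq_bigr => j _; rewrite mxE mulrC.
Qed.

Lemma measurable_sqnorm (u : 'cV[R]_N) :
  measurable_fun [set: T] (fun w => sqnorm (random_matrix X w *m u)).
Proof.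
rewrite (_ : (fun _ => _) =
    fun w => \sum_(i < n) (\sum_(j < N) u j 0 * X i j w) ^+ 2); last first.
  by apply/funext => w; exact: sqnorm_random_matrix.
apply: measurable_sum => i; apply: measurable_funX.
by apply: measurable_sum => j; exact: measurable_funM.
Qed.

Lemma measurable_distortion (u : 'cV[R]_N) :
  measurable_fun [set: T] (fun w => distortion (random_matrix X w) u).
Proof. by apply: measurable_funB => //; exact: measurable_sqnorm. Qed.

Lemma measurable_distortion_ge (sg y : R) (u : 'cV[R]_N) :
  measurable [set w | y <= sg * distortion (random_matrix X w) u].
Proof.
rewrite (_ : [set w | _] =
    (fun w => sg * distortion (random_matrix X w) u) @^-1` `[y, +oo[).
  rewrite -[X in measurable X]setTI; apply: measurable_funM => //.
  exact: measurable_distortion.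
by apply/seteqP; split=> w /=; rewrite in_itv/= andbT.
Qed.

Hypothesis XG : gaussian_matrix X.
Hypothesis n0 : (0 < n)%N.

Lemma gaussian_matrix_mgf (mu : R) (u : 'cV[R]_N) : 0 < 1 + 2 * mu * sqnorm u ->
  (\int[P]_w (expR (- (mu * n%:R * sqnorm (random_matrix X w *m u))))%:E =
   ((Num.sqrt (1 + 2 * mu * sqnorm u))^-1 ^+ n)%:E)%E.
Proof.
move=> pos; have [Xi Xn] := XG.
have nR0 : (0 : R) < n%:R by rewrite ltr0n.
pose s : R := Num.sqrt (1 / n%:R).
have s0 : s != 0 by rewrite gt_eqF// sqrtr_gt0 divr_gt0.
have s2 : s ^+ 2 = 1 / n%:R by rewrite sqr_sqrtr// divr_ge0// ltW.
pose cols (i : 'I_n) := [seq (i, j) | j <- enum 'I_N].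
have sum_cols i (f : 'I_n * 'I_N -> R) :
    \sum_(p <- cols i) f p = \sum_(j < N) f (i, j).
  by rewrite /cols big_map big_enum.
have := @gaussian_squares_mgf R d T P _ (fun p : 'I_n * 'I_N => X p.1 p.2) s Xi
  (fun p => Xn p.1 p.2) s0 'I_n cols (mu * n%:R) (fun p => u p.2 0) (sqnorm u).
have -> : 1 + 2 * (mu * n%:R) * s ^+ 2 * sqnorm u = 1 + 2 * mu * sqnorm u.
  by rewrite s2; field; rewrite gt_eqF.
rewrite card_ord => <-//.
- apply: eq_integral => w _; congr (expR (- (_ * _)))%:E.
  by rewrite sqnorm_random_matrix; apply: eq_bigr => i _; rewrite sum_cols.
- by move=> i; rewrite map_inj_uniq ?enum_uniq// => j j' [].
- by move=> i i' p /mapP[j _ ->] /mapP[j' _ []].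
Qed.

(** Chernoff's bound, with [sg] = 1 for the upper tail and [sg] = -1 for the lower
one.  With the quadratic coefficient 11/20 of [expR_quadratic_le1Dx], the exponent
is at most n (- lam y + (11/10) lam^2), which is minimal at lam = (5/11) y; the condition
[y <= 1/10] keeps |2 lam| within 1/11. *)
Lemma distortion_tail (sg : R) (u : 'cV[R]_N) (y : R) : sg ^+ 2 = 1 ->
  sqnorm u <= 1 -> 0 <= y <= 1/10 ->
  (P [set w | (y <= sg * distortion (random_matrix X w) u)%R] <=
   (expR (- (5/22 * y ^+ 2 * n%:R)))%:E)%E.
Proof.
move=> sg2 u1 /andP[y0 y1].
have u0 := sqnorm_ge0 u.
have sgP : -1 <= sg <= 1.
  by rewrite -ler_norml -(@ler_pXn2r _ 2)// ?nnegrE// expr1n -normrX sg2 normr1.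
pose lam := 5/11 * y; pose t := sqnorm u.
pose mu := - (sg * lam).
pose s := 2 * mu * t.
have s_small : `|s| <= 1/11.
  rewrite /s /mu /t ler_norml; move/andP: sgP => [sg1 sg1'].
  have lt0 : 0 <= lam * sqnorm u by rewrite mulr_ge0// /lam; lra.
  have lt1 : lam * sqnorm u <= 1/22.
    have : lam * sqnorm u <= lam * 1 by rewrite ler_wpM2l// /lam; lra.
    rewrite /lam; lra.
  nra.
have pos : 0 < 1 + s by move: s_small; rewrite ler_norml; lra.
pose Y w := expR (n%:R * lam * (sg * distortion (random_matrix X w) u - y)).
have mY : measurable_fun [set: T] Y.
  apply: measurableT_comp => //; apply: measurable_funM => //.
  apply: measurable_funB => //; apply: measurable_funM => //.
  exact: measurable_distortion.
pose E := [set w | y <= sg * distortion (random_matrix X w) u].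
have mE : measurable E := measurable_distortion_ge sg y u.
have YE w : Y w = expR (- (n%:R * (lam * y - mu * t))) *
    expR (- (mu * n%:R * sqnorm (random_matrix X w *m u))).
  by rewrite -expRD /Y /distortion /mu -/t; congr expR; ring.
apply: (@le_trans _ _ (\int[P]_w (Y w)%:E)%E).
  rewrite -[leLHS]mul1e -[leLHS](integral_cst P mE 1).
  apply: (@le_trans _ _ (\int[P]_(w in E) (Y w)%:E)%E).
    apply: ge0_le_integral => //.
    - by apply/measurable_EFinP; exact: measurable_funTS.
    - move=> w /= yw; rewrite lee_fin /Y -expR0 ler_expR mulr_ge0 ?subr_ge0//.
      by rewrite mulr_ge0// /lam; lra.
  apply: ge0_subset_integral => //; first exact/measurable_EFinP.
  by move=> w _; rewrite lee_fin expR_ge0.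
under eq_integral do rewrite YE EFinM.
rewrite ge0_integralZl//; last first.
  apply/measurable_EFinP; apply: measurableT_comp => //.
  apply: measurableT_comp => //; apply: measurable_funM => //.
  exact: measurable_sqnorm.
rewrite gaussian_matrix_mgf// -EFinM lee_fin.
have sqrt_le : (Num.sqrt (1 + s))^-1 <= expR ((- s + 11/20 * s ^+ 2) / 2).
  rewrite -(@ler_pXn2r _ 2)// ?nnegrE ?expR_ge0 ?invr_ge0 ?sqrtr_ge0//.
  rewrite exprVn sqr_sqrtr ?(ltW pos)// -expRM_natl.
  rewrite [X in expR X](_ : _ = - (s - 11/20 * s ^+ 2)); last by field.
  rewrite expRN lef_pV2 ?posrE ?expR_gt0//.
  by apply: expR_quadratic_le1Dx; move: s_small; rewrite ler_norml; lra.
apply: (@le_trans _ _ (expR (- (n%:R * (lam * y - mu * t))) *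
    expR ((- s + 11/20 * s ^+ 2) / 2) ^+ n)).
  by rewrite ler_wpM2l ?expR_ge0// lerXn2r ?nnegrE ?invr_ge0 ?sqrtr_ge0 ?expR_ge0.
rewrite -expRM_natl -expRD ler_expR.
rewrite [leLHS](_ : _ = - (lam * y - 11/10 * (lam * t) ^+ 2 * sg ^+ 2) * n%:R); last first.
  by rewrite /s /mu; field.
rewrite -[leRHS]mulNr ler_wpM2r// sg2 mulr1.
have lt2 : (lam * t) ^+ 2 <= lam ^+ 2.
  by rewrite exprMn ler_piMr ?sqr_ge0// exprn_ile1.
by rewrite /lam in lt2 *; nra.
Qed.

End gaussian.
End tails.

(** * A net of sparse vectors and its cardinality *)
Section lattice_net.
Context {R : realType}.
Variables (m k N : nat).
Hypotheses (m0 : (0 < m)%N) (k0 : (0 < k)%N).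

(** A coordinate is a sign and an absolute value.  Zero has two codes, which only
makes the net larger; the bound on the absolute value is implied by the bound on
the sum of squares and makes the type finite. *)
Definition coord_code := (bool * 'I_(m ^ 2 * k).+1)%type.

Definition lattice_net (S : {set 'I_N}) : {set {ffun 'I_N -> coord_code}} :=
  [set f | (f \in pffun_on (false, ord0) (mem S) predT) &&
           (\sum_i (f i).2 ^ 2 <= m ^ 2 * k)%N].

Definition lattice_point (f : {ffun 'I_N -> coord_code}) : 'cV[R]_N :=
  \col_i ((-1) ^+ (f i).1 * (f i).2%:R / (m%:R * Num.sqrt k%:R)).

Lemma sum_half_powers (n : nat) : \sum_(b < n) (1 / 2 : R) ^+ b <= 2.
Proof.
suff -> : \sum_(b < n) (1 / 2 : R) ^+ b = 2 - 2 * (1 / 2) ^+ n.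
  by rewrite lerBlDr lerDl mulr_ge0// exprn_ge0.
elim: n => [|n IH]; first by rewrite big_ord0 expr0 mulr1 subrr.
by rewrite big_ord_recr/= IH exprS; field.
Qed.

(** A code with coordinates b_i satisfies sum b_i <= sum b_i^2 <= m^2 k, so each code
has weight at least 1 when weighted by 2^(m^2 k) prod 2^(- b_i); the total weight
factorizes over the k coordinates, and each factor is at most 2 * 2. *)
Lemma card_lattice_net (S : {set 'I_N}) : #|S| = k ->
  (#|lattice_net S|%:R : R) <= (4 * 2 ^+ (m ^ 2)) ^+ k.
Proof.
move=> Sk.
pose w (c : coord_code) : R := (1 / 2) ^+ c.2.
have w0 c : 0 <= w c by rewrite exprn_ge0.
have -> : (4 * 2 ^+ (m ^ 2)) ^+ k = 2 ^+ (m ^ 2 * k) * 4 ^+ k :> R.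
  by rewrite exprMn mulrC -exprM.
have -> : (#|lattice_net S|%:R : R) = \sum_(f in lattice_net S) 1.
  by rewrite sumr_const.
apply: (@le_trans _ _ (\sum_(f in lattice_net S)
    2 ^+ (m ^ 2 * k) * \prod_(i in S) w (f i))).
  apply: ler_sum => f; rewrite inE => /andP[_ fle].
  have -> : \prod_(i in S) w (f i) = (1 / 2) ^+ (\sum_(i in S) (f i).2)%N.
    by rewrite /w -prodrXr.
  have le1 : (\sum_(i in S) (f i).2 <= m ^ 2 * k)%N.
    apply: leq_trans fle; rewrite [leqRHS](bigID (fun i => i \in S))/=.
    apply: leq_trans (leq_addr _ _); apply: leq_sum => i _.
    by case: (nat_of_ord _) => // b; rewrite expnS expn1 leq_pmulr.
  by rewrite expr_div_n expr1n mul1r ler_pdivlMr ?exprn_gt0// mul1r ler_weXn2l// ler1n.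
rewrite -mulr_sumr ler_wpM2l ?exprn_ge0//.
apply: (@le_trans _ _ (\sum_(f in pffun_on (false, ord0) (mem S) predT)
    \prod_(i in S) w (f i))).
  rewrite [leRHS](bigID (fun f => f \in lattice_net S))/=.
  rewrite (eq_bigl (fun f => (f \in pffun_on (false, ord0) (mem S) predT) &&
      (f \in lattice_net S))); last first.
    move=> f; apply/idP/andP => [fN|[]//]; split=> //.
    by move: fN; rewrite inE => /andP[].
  by rewrite lerDl sumr_ge0// => f _; apply: prodr_ge0.
rewrite -(big_distr_big (false, ord0) (fun i => i \in S) predT (fun _ c => w c)).
rewrite prodr_const Sk lerXn2r ?nnegrE ?sumr_ge0//.
rewrite -(pair_bigA _ (fun s b => w (s, b)))/= big_bool /=.
have := sum_half_powers (m ^ 2 * k).+1; rewrite /w /=; lra.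
Qed.

Lemma sqnorm_lattice_point_le1 (S : {set 'I_N}) f : f \in lattice_net S ->
  sqnorm (lattice_point f) <= 1.
Proof.
rewrite inE => /andP[_ fle].
have mR : (0 : R) < m%:R by rewrite ltr0n.
have kR : (0 : R) < k%:R by rewrite ltr0n.
have -> : sqnorm (lattice_point f) = (\sum_i (f i).2 ^ 2)%N%:R / (m ^ 2 * k)%:R.
  rewrite natr_sum mulr_suml; apply: eq_bigr => i _.
  rewrite mxE expr_div_n [in LHS]exprMn sqrr_sign mul1r -natrX exprMn.
  by rewrite sqr_sqrtr ?(ltW kR)// natrM (natrX _ m).
by rewrite ler_pdivrMr ?ltr0n ?muln_gt0 ?expn_gt0 ?m0// mul1r ler_nat.
Qed.

(** Truncation towards 0 does not increase the norm, so the point stays in the unit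
ball; each of the k coordinates moves by at most 1 / (m sqrt k). *)
Lemma lattice_net_approx (S : {set 'I_N}) (u : 'cV[R]_N) : #|S| = k ->
  sqnorm u = 1 -> (forall i, i \notin S -> u i 0 = 0) ->
  exists2 f, f \in lattice_net S &
    [/\ sqnorm (lattice_point f) <= 1,
        sqnorm (u - lattice_point f) <= 1 / m%:R ^+ 2 &
        forall i, i \notin S -> lattice_point f i 0 = 0].
Proof.
move=> Sk u1 uS.
pose c : R := m%:R * Num.sqrt k%:R.
have mR : (0 : R) < m%:R by rewrite ltr0n.
have kR : (0 : R) < k%:R by rewrite ltr0n.
have c0 : 0 < c by rewrite mulr_gt0// sqrtr_gt0.
have c2 : c ^+ 2 = (m ^ 2 * k)%:R by rewrite exprMn sqr_sqrtr ?(ltW kR)// natrM natrX.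
pose z i := Num.truncn (c * `|u i 0|).
have zle i : (z i)%:R <= c * `|u i 0|.
  by have /andP[] := @truncn_itv R (c * `|u i 0|) (mulr_ge0 (ltW c0) (normr_ge0 _)).
have zgt i : c * `|u i 0| < (z i)%:R + 1.
  have /andP[_] := @truncn_itv R (c * `|u i 0|) (mulr_ge0 (ltW c0) (normr_ge0 _)).
  by rewrite -natr1.
have z2le i : (z i ^ 2)%:R <= c ^+ 2 * u i 0 ^+ 2.
  rewrite natrX -[u i 0 ^+ 2]real_normK ?num_real// -exprMn.
  by rewrite lerXn2r ?nnegrE// mulr_ge0// ltW.
have sum_z : (\sum_i z i ^ 2 <= m ^ 2 * k)%N.
  rewrite -(ler_nat R) natr_sum -c2 -[leRHS]mulr1 -[X in _ <= _ * X]u1 mulr_sumr.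
  by apply: ler_sum => i _; exact: z2le.
have zB i : (z i < (m ^ 2 * k).+1)%N.
  rewrite ltnS; apply: leq_trans sum_z; rewrite (bigD1 i)//=.
  apply: leq_trans (leq_addr _ _).
  by case: (z i) => // b; rewrite expnS expn1 leq_pmulr.
pose f := [ffun i => ((u i 0 < 0), Ordinal (zB i)) : coord_code].
have vE i : lattice_point f i 0 = (-1) ^+ (u i 0 < 0)%R * (z i)%:R / c.
  by rewrite mxE ffunE.
have z0 i : i \notin S -> z i = 0%N.
  by move=> /uS ui; rewrite /z ui normr0 mulr0 truncn0.
have fN : f \in lattice_net S.
  rewrite inE; apply/andP; split; last by under eq_bigr do rewrite ffunE.
  apply/pffun_onP; split => //.
  apply/supportP => i iS; rewrite ffunE uS// ltxx; congr (_, _).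
  by apply/val_inj; exact: z0.
exists f => //; split.
- exact: sqnorm_lattice_point_le1 fN.
- apply: (@le_trans _ _ (\sum_(i in S) 1 / c ^+ 2)).
    rewrite /sqnorm (bigID (fun i => i \in S))/= [X in _ + X]big1 ?addr0; last first.
      by move=> i iS; rewrite mxE [in X in _ + X]mxE vE uS// z0// mulr0 mul0r subrr expr0n.
    apply: ler_sum => i _; rewrite mxE [in X in _ + X]mxE vE.
    rewrite [X in (X + _) ^+ 2](realEsign (num_real (u i 0))) -mulrA -mulrBr.
    rewrite exprMn sqrr_sign mul1r.
    have -> : `|u i 0| - (z i)%:R / c = (c * `|u i 0| - (z i)%:R) / c.
      by field; rewrite gt_eqF.
    rewrite mul1r expr_div_n ler_piMl ?invr_ge0 ?sqr_ge0// exprn_ile1 ?subr_ge0//.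
    by rewrite lerBlDl ltW.
  rewrite sumr_const Sk c2 natrM natrX -mulr_natr.
  by rewrite le_eqVlt; apply/orP; left; apply/eqP; field; rewrite !gt_eqF.
- by move=> i iS; rewrite vE z0// mulr0 mul0r.
Qed.

End lattice_net.

(** * From the net to the restricted isometry constants *)
Section net_to_RIC.
Context {R : realType}.

Lemma sqnormZ m (a : R) (x : 'cV[R]_m) : sqnorm (a *: x) = a ^+ 2 * sqnorm x.
Proof.
by rewrite /sqnorm mulr_sumr; apply: eq_bigr => i _; rewrite mxE exprMn.
Qed.

Lemma distortionZ n N (A : 'M[R]_(n, N)) (a : R) x :
  distortion A (a *: x) = a ^+ 2 * distortion A x.
Proof. by rewrite /distortion -scalemxAr !sqnormZ mulrBr. Qed.

Lemma sqnorm_polar m (t : R) (u v : 'cV[R]_m) : t != 0 ->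
  sqnorm (t *: (u + v) + t^-1 *: (u - v)) -
  sqnorm (t *: (u + v) - t^-1 *: (u - v)) = 4 * (sqnorm u - sqnorm v).
Proof.
move=> t0; rewrite /sqnorm -!sumrB mulr_sumr; apply: eq_bigr => i _.
by rewrite !mxE; field.
Qed.

Lemma sqnorm_parallelogram m (a b : 'cV[R]_m) :
  sqnorm (a + b) + sqnorm (a - b) = 2 * (sqnorm a + sqnorm b).
Proof.
rewrite /sqnorm -!big_split mulr_sumr; apply: eq_bigr => i _ /=.
by rewrite !mxE; ring.
Qed.

Lemma distortion_polar n N (A : 'M[R]_(n, N)) (t : R) (u v : 'cV[R]_N) : t != 0 ->
  distortion A (t *: (u + v) + t^-1 *: (u - v)) -
  distortion A (t *: (u + v) - t^-1 *: (u - v)) =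
  4 * (distortion A u - distortion A v).
Proof.
move=> t0; have := sqnorm_polar (A *m u) (A *m v) t0; have := sqnorm_polar u v t0.
rewrite /distortion !(mulmxDr, mulmxN, =^~ scalemxAr).
lra.
Qed.

(** The difference q(u) - q(v) is the bilinear form of q at (u + v, u - v), which the
polarization identity expresses by two values of q.  Scaling the two arguments by t
and 1/t, with t^2 = eta / 2, balances |u + v| <= 2 against |u - v| <= eta. *)
Lemma distortion_lipschitz n N (A : 'M[R]_(n, N)) (D eta : R) (u v : 'cV[R]_N) :
  0 < eta -> 0 <= D ->
  (forall a b, `|distortion A (a *: u + b *: v)| <= D * sqnorm (a *: u + b *: v)) ->
  sqnorm u <= 1 -> sqnorm v <= 1 -> sqnorm (u - v) <= eta ^+ 2 ->
  `|distortion A u - distortion A v| <= 2 * eta * D.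
Proof.
move=> eta0 D0 qD u1 v1 uv.
pose t := Num.sqrt (eta / 2).
have t2 : t ^+ 2 = eta / 2 by rewrite sqr_sqrtr// divr_ge0// ltW.
have t0 : t != 0 by rewrite gt_eqF// sqrtr_gt0 divr_gt0.
pose a := t *: (u + v); pose b := t^-1 *: (u - v).
have abE (s : R) : a + s *: b = (t + s / t) *: u + (t - s / t) *: v.
  by apply/colP => i; rewrite !mxE; ring.
have qab : `|distortion A (a + b)| <= D * sqnorm (a + b).
  by have := abE 1; rewrite scale1r => ->; exact: qD.
have qab' : `|distortion A (a - b)| <= D * sqnorm (a - b).
  by have := abE (-1); rewrite scaleN1r => ->; exact: qD.
have sum_le : sqnorm (a + b) + sqnorm (a - b) <= 8 * eta.
  rewrite sqnorm_parallelogram /a /b !sqnormZ exprVn t2.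
  have uv4 : sqnorm (u + v) <= 4.
    have := sqnorm_parallelogram u v; have := sqnorm_ge0 (u - v); lra.
  have e1 : eta / 2 * sqnorm (u + v) <= eta / 2 * 4 by rewrite ler_wpM2l// divr_ge0// ltW.
  have e2 : (eta / 2)^-1 * sqnorm (u - v) <= (eta / 2)^-1 * eta ^+ 2.
    by rewrite ler_wpM2l// invr_ge0 divr_ge0// ltW.
  have e3 : (eta / 2)^-1 * eta ^+ 2 = 2 * eta by field; rewrite gt_eqF.
  lra.
have := distortion_polar A u v t0; rewrite -/a -/b => E.
have : 4 * `|distortion A u - distortion A v| <= D * (sqnorm (a + b) + sqnorm (a - b)).
  rewrite -[4]ger0_norm// -normrM -E mulrDr.
  by apply: (le_trans (ler_normB _ _)); exact: lerD.
have := ler_wpM2l D0 sum_le; lra.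
Qed.

Lemma l2norm_sq m (x : 'cV[R]_m) : l2norm x ^+ 2 = sqnorm x.
Proof. by rewrite sqr_sqrtr// sqnorm_ge0. Qed.

Lemma sqnorm_gt0 m (x : 'cV[R]_m) : x != 0 -> 0 < sqnorm x.
Proof.
move=> x0; rewrite lt_neqAle sqnorm_ge0 andbT eq_sym.
apply: contra x0; rewrite psumr_eq0 => [/allP x0|i _]; last exact: sqr_ge0.
apply/eqP/colP => i; rewrite mxE; apply/eqP; rewrite -sqrf_eq0.
by apply: x0; rewrite mem_index_enum.
Qed.

(** Supports of size exactly [k] suffice, and are the ones counted by binomial
coefficients. *)
Lemma sparse_supportP N k (x : 'cV[R]_N) : (k <= N)%N ->
  sparse k x <-> exists2 S : {set 'I_N}, #|S| = k & forall i, i \notin S -> x i 0 = 0.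
Proof.
move=> kN; split=> [xk|[S Sk xS]]; last first.
  rewrite /sparse/= /nnz -Sk; apply: subset_leq_card.
  by apply/fintype.subsetP => i; rewrite inE; apply: contraR => /xS ->.
pose B := [set i | x i 0 == 0]%SET.
have cB : (k - nnz x <= #|B|)%N.
  rewrite leq_subLR (leq_trans kN)//.
  have -> : nnz x = #|[set i | x i 0 != 0]%SET| by rewrite cardsE.
  rewrite -[leqLHS]card_ord -(cardsC [set i | x i 0 != 0]%SET).
  rewrite leq_add2l; apply: subset_leq_card; apply/fintype.subsetP => i.
  by rewrite !inE negbK.
have : (0 < #|[set A : {set 'I_N} | A \subset B & #|A| == (k - nnz x)%N]|)%N.
  by rewrite cards_draws bin_gt0.
move=> /card_gt0P[C]; rewrite inE => /andP[CB /eqP Cc].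
exists ([set i | x i 0 != 0]%SET :|: C).
  rewrite cardsU Cc disjoint_setI0 ?cards0 ?subn0 ?cardsE.
    by rewrite -/(nnz x) subnKC.
  rewrite disjoint_sym finset.disjoints_subset (fintype.subset_trans CB)//.
  by apply/fintype.subsetP => i; rewrite !inE negbK.
by move=> i; rewrite !inE negb_or negbK => /andP[/eqP].
Qed.

Lemma RIC_bounds n N k (A : 'M[R]_(n, N)) (x : 'cV[R]_N) :
  (0 < k)%N -> (0 < N)%N -> sparse k x ->
  - RIC_L k A * sqnorm x <= distortion A x <= RIC_U k A * sqnorm x.
Proof.
move=> k0 N0 xk; have [->|x0] := eqVneq x 0.
  by rewrite -(scale0r (0 : 'cV[R]_N)) distortionZ sqnormZ expr0n !mul0r !mulr0 lexx.
have x2 := sqnorm_gt0 x0.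
have xr : sparse_ratios k A (sqnorm (A *m x) / sqnorm x).
  by exists x => //; rewrite /isometry_ratio !l2norm_sq.
have [_ /(_ _ xr)] := sparse_ratios_min A k0 N0.
have [_ /(_ _ xr)] := sparse_ratios_max A k0 N0.
by rewrite ler_pdivrMr// ler_pdivlMr// /distortion /RIC_L /RIC_U; lra.
Qed.

Lemma distortion_le_RIC n N k (A : 'M[R]_(n, N)) (x : 'cV[R]_N) :
  (0 < k)%N -> (0 < N)%N -> sparse k x ->
  `|distortion A x| <= Num.max (RIC_L k A) (RIC_U k A) * sqnorm x.
Proof.
move=> k0 N0 xk; have /andP[L U] := RIC_bounds A k0 N0 xk.
have ml : RIC_L k A * sqnorm x <= Num.max (RIC_L k A) (RIC_U k A) * sqnorm x.
  by rewrite ler_wpM2r ?sqnorm_ge0// le_max lexx.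
have mu : RIC_U k A * sqnorm x <= Num.max (RIC_L k A) (RIC_U k A) * sqnorm x.
  by rewrite ler_wpM2r ?sqnorm_ge0// le_max lexx orbT.
by move: ml mu; rewrite ler_norml; lra.
Qed.

Lemma RIC_attained n N k (A : 'M[R]_(n, N)) : (0 < k)%N -> (0 < N)%N ->
  exists u : 'cV[R]_N, [/\ sparse k u, sqnorm u = 1 &
    `|distortion A u| = `|Num.max (RIC_L k A) (RIC_U k A)|].
Proof.
move=> k0 N0.
have unit_ratio r : sparse_ratios k A r ->
    exists u : 'cV[R]_N, [/\ sparse k u, sqnorm u = 1 & distortion A u = r - 1].
  move=> [x [xk x0] <-]; have x2 := sqnorm_gt0 x0.
  have l0 : l2norm x != 0 by rewrite -sqrf_eq0 l2norm_sq gt_eqF.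
  exists ((l2norm x)^-1 *: x); split.
  - rewrite /sparse/= (leq_trans _ xk)//; apply: subset_leq_card.
    apply/fintype.subsetP => i; rewrite !inE mxE.
    by rewrite mulf_eq0 negb_or => /andP[].
  - by rewrite sqnormZ exprVn l2norm_sq mulVf// gt_eqF.
  - rewrite distortionZ exprVn /isometry_ratio !l2norm_sq /distortion.
    by field; rewrite gt_eqF.
rewrite maxEle; case: ifP => _.
  have [/unit_ratio[u [uk u1 uE]] _] := sparse_ratios_max A k0 N0.
  by exists u; rewrite uE.
have [/unit_ratio[u [uk u1 uE]] _] := sparse_ratios_min A k0 N0.
by exists u; rewrite uE /RIC_L distrC.
Qed.

(** Let D be the larger of the two constants and u a sparse unit vector where |q| = D.
A net vector v close to u with the same support has |q(v)| >= D - 2 D / m. *)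
Lemma RIC_le_lattice_net n N k m (A : 'M[R]_(n, N)) (y : R) :
  (2 < m)%N -> (0 < k <= N)%N ->
  (forall S : {set 'I_N}, #|S| = k -> forall f, f \in lattice_net m k S ->
     `|distortion A (lattice_point f)| < y) ->
  RIC_L k A < y / (1 - 2 / m%:R) /\ RIC_U k A < y / (1 - 2 / m%:R).
Proof.
move=> m2 /andP[k0 kN] net_lt.
have N0 : (0 < N)%N := leq_trans k0 kN.
have m0 : (0 < m)%N by apply: ltn_trans m2.
have mR : (0 : R) < m%:R by rewrite ltr0n.
set D := Num.max (RIC_L k A) (RIC_U k A).
have [u [uk u1 uD]] := RIC_attained A k0 N0.
have D0 : 0 <= D.
  have := distortion_le_RIC A k0 N0 uk; rewrite u1 mulr1 -/D.
  exact: le_trans.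
have [S Sk uS] := (sparse_supportP u kN).1 uk.
have [f fN [v1 uv vS]] := lattice_net_approx m0 k0 Sk u1 uS.
set v := lattice_point f in v1 uv vS.
have lip : `|distortion A u - distortion A v| <= 2 * (1 / m%:R) * D.
  apply: distortion_lipschitz => //.
  - by rewrite divr_gt0.
  - move=> a b; apply: distortion_le_RIC => //.
    apply/sparse_supportP => //; exists S => // i iS.
    by rewrite mxE [X in X + _]mxE [X in _ + X]mxE uS// vS// !mulr0 addr0.
  - by rewrite u1.
  - by rewrite expr_div_n expr1n.
have Dlt : D * (1 - 2 / m%:R) < y.
  have tri : `|distortion A u| <= `|distortion A u - distortion A v| + `|distortion A v|.
    by rewrite -{1}(subrK (distortion A v) (distortion A u)) ler_normD.
  have yv := net_lt S Sk f fN; rewrite -/v in yv.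
  rewrite uD -/D ger0_norm// in tri.
  have -> : D * (1 - 2 / m%:R) = D - 2 * (1 / m%:R) * D by field; rewrite gt_eqF.
  lra.
have pos : 0 < 1 - 2 / m%:R :> R.
  by rewrite subr_gt0 ltr_pdivrMr// mul1r ltr_nat.
rewrite !ltr_pdivlMr//; split; apply: le_lt_trans Dlt; rewrite ler_wpM2r ?(ltW pos)//.
  by rewrite /D le_max lexx.
by rewrite /D le_max lexx orbT.
Qed.

End net_to_RIC.

(** * Measurability of the restricted isometry constants *)
Section measurability.
Context {R : realType}.

(** The factor 1, like -1 in the next lemma, makes both constants instances of the
signed inequality of [distortion_le_int]. *)
Lemma RIC_U_leP n N k (A : 'M[R]_(n, N)) (b : R) : (0 < k)%N -> (0 < N)%N ->
  RIC_U k A <= b <-> forall x, sparse k x -> 1 * distortion A x <= b * sqnorm x.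
Proof.
move=> k0 N0; split=> [Ub x xk|h].
  have /andP[L U] := RIC_bounds A k0 N0 xk.
  have : RIC_U k A * sqnorm x <= b * sqnorm x by rewrite ler_wpM2r ?sqnorm_ge0.
  lra.
have [[x [xk x0] E] _] := sparse_ratios_max A k0 N0.
have x2 := sqnorm_gt0 x0.
rewrite /RIC_U -E lerBlDr /isometry_ratio !l2norm_sq ler_pdivrMr//.
by have := h x xk; rewrite /distortion; lra.
Qed.

Lemma RIC_L_leP n N k (A : 'M[R]_(n, N)) (b : R) : (0 < k)%N -> (0 < N)%N ->
  RIC_L k A <= b <-> forall x, sparse k x -> -1 * distortion A x <= b * sqnorm x.
Proof.
move=> k0 N0; split=> [Ub x xk|h].
  have /andP[L U] := RIC_bounds A k0 N0 xk.
  have : RIC_L k A * sqnorm x <= b * sqnorm x by rewrite ler_wpM2r ?sqnorm_ge0.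
  lra.
have [[x [xk x0] E] _] := sparse_ratios_min A k0 N0.
have x2 := sqnorm_gt0 x0.
rewrite /RIC_L -E lerBlDr -lerBlDl /isometry_ratio !l2norm_sq ler_pdivlMr//.
by have := h x xk; rewrite /distortion; lra.
Qed.

Lemma cvg_sqnorm m (x_ : nat -> 'cV[R]_m) (x : 'cV[R]_m) :
  (forall i, (fun p => x_ p i 0) @ \oo --> x i 0) ->
  (fun p => sqnorm (x_ p)) @ \oo --> sqnorm x.
Proof.
move=> xx; rewrite /sqnorm; apply: cvg_big => [|i _]; first exact: add_continuous.
under eq_fun do rewrite expr2; rewrite expr2.
by apply: cvgM; exact: xx.
Qed.

Lemma cvg_distortion n N (A : 'M[R]_(n, N)) (x_ : nat -> 'cV[R]_N) (x : 'cV[R]_N) :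
  (forall i, (fun p => x_ p i 0) @ \oo --> x i 0) ->
  (fun p => distortion A (x_ p)) @ \oo --> distortion A x.
Proof.
move=> xx; apply: cvgB; last exact: cvg_sqnorm.
apply: cvg_sqnorm => i; under eq_fun do rewrite mxE; rewrite mxE.
apply: cvg_big => [|j _]; first exact: add_continuous.
by apply: cvgM; [exact: cvg_cst|exact: xx].
Qed.

(** Both sides are homogeneous of degree 2, so the hypothesis extends to rational
vectors; the vectors floor((p + 1) x) / (p + 1) converge to x and vanish where x
does. *)
Lemma distortion_le_int n N k (A : 'M[R]_(n, N)) (sg b : R) :
  (forall z : 'cV[int]_N, sparse k (map_mx intr z : 'cV[R]_N) ->
     sg * distortion A (map_mx intr z) <= b * sqnorm (map_mx intr z : 'cV[R]_N)) ->
  forall x, sparse k x -> sg * distortion A x <= b * sqnorm x.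
Proof.
move=> hz x xk.
pose z_ (p : nat) : 'cV[int]_N := \col_i Num.floor (p.+1%:R * x i 0).
pose x_ (p : nat) : 'cV[R]_N := p.+1%:R^-1 *: map_mx intr (z_ p).
have xp p : sg * distortion A (x_ p) - b * sqnorm (x_ p) <= 0.
  rewrite subr_le0 distortionZ sqnormZ mulrCA (mulrCA b) ler_wpM2l ?sqr_ge0//.
  apply: hz; apply: leq_trans xk; apply: subset_leq_card.
  apply/fintype.subsetP => i; rewrite !inE !mxE.
  by apply: contra => /eqP ->; rewrite mulr0 floor0.
have xx i : (fun p => x_ p i 0) @ \oo --> x i 0.
  apply: (@squeeze_cvgr _ _ _ _ (fun p => x i 0 - p.+1%:R^-1) (fun=> x i 0)).
  - near=> p; have p0 : (0 : R) < p.+1%:R by rewrite ltr0n.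
    rewrite !mxE; have /andP[f1 f2] := real_floor_itv (num_real (p.+1%:R * x i 0)).
    rewrite mulrC ler_pdivlMr// ler_pdivrMr// mulrBl mulVf ?gt_eqF// mulrC lerBlDr.
    by rewrite (le_trans (ltW f2)) ?intrD//=.
  - rewrite -[X in _ --> X]subr0; apply: cvgB; first exact: cvg_cst.
    exact: cvg_harmonic.
  - exact: cvg_cst.
rewrite -subr_le0; apply: (@cvgr_to_le _ \oo _ _
    (fun p => sg * distortion A (x_ p) - b * sqnorm (x_ p))).
  apply: cvgB; (apply: cvgM; first exact: cvg_cst); first exact: cvg_distortion.
  exact: cvg_sqnorm.
by near=> p.
Unshelve. all: by end_near. Qed.

Context {d : measure_display} {T : measurableType d} (P : probability T R).
Context (n N : nat) (X : 'I_n -> 'I_N -> {RV P >-> R}).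

(** By [distortion_le_int], a countable intersection over integer vectors. *)
Lemma measurable_sparse_distortion_le k (sg b : R) :
  measurable [set w | forall x, sparse k x ->
    sg * distortion (random_matrix X w) x <= b * sqnorm x].
Proof.
pose F (z : 'cV[int]_N) : set T := [set w |
  sparse k (map_mx intr z : 'cV[R]_N) ->
  sg * distortion (random_matrix X w) (map_mx intr z) <=
    b * sqnorm (map_mx intr z : 'cV[R]_N)].
have mF z : measurable (F z).
  rewrite /F; have [zk|zk] := pselect (sparse k (map_mx intr z : 'cV[R]_N)); last first.
    rewrite (_ : [set w | _] = setT); first exact: measurableT.
    by apply/seteqP; split=> w //= _ /zk.
  rewrite (_ : [set w | _] =
      (fun w => sg * distortion (random_matrix X w) (map_mx intr z)) @^-1`
      `]-oo, b * sqnorm (map_mx intr z : 'cV[R]_N)]).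
    rewrite -[X in measurable X]setTI; apply: measurable_funM => //.
    exact: measurable_distortion.
  by apply/seteqP; split=> w /=; rewrite in_itv/=; [apply|].
rewrite (_ : [set w | _] = \bigcap_p (if unpickle p is Some z then F z else setT)).
  by apply: bigcapT_measurable => p; case: (unpickle p).
apply/seteqP; split=> w /= hw.
  by move=> p _; case: (unpickle p) => // z zk; exact: hw.
apply: distortion_le_int => z zk.
by have := hw (pickle z) I; rewrite pickleK; apply.
Qed.

Lemma measurable_lt_of_le (f : T -> R) (a : R) :
  (forall b, measurable [set w | f w <= b]) -> measurable [set w | f w < a].
Proof.
move=> mf; rewrite (_ : [set w | _] = \bigcup_p [set w | f w <= a - p.+1%:R^-1]).
  by apply: bigcup_measurable => p _; exact: mf.
apply/seteqP; split=> w /=.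
  rewrite -subr_gt0 => /ltr_add_invr [p]; rewrite add0r => hp.
  by exists p => //=; rewrite lerBrDr -lerBrDl ltW.
move=> [p _] /= /le_lt_trans; apply; by rewrite ltrBlDr ltrDl invr_gt0 ltr0n.
Qed.

Lemma measurable_RIC_U_lt k (a : R) : (0 < k)%N -> (0 < N)%N ->
  measurable [set w | RIC_U k (random_matrix X w) < a].
Proof.
move=> k0 N0; apply: measurable_lt_of_le => b.
have := measurable_sparse_distortion_le k 1 b; congr measurable.
by apply/seteqP; split=> w /= /RIC_U_leP; exact.
Qed.

Lemma measurable_RIC_L_lt k (a : R) : (0 < k)%N -> (0 < N)%N ->
  measurable [set w | RIC_L k (random_matrix X w) < a].
Proof.
move=> k0 N0; apply: measurable_lt_of_le => b.
have := measurable_sparse_distortion_le k (-1) b; congr measurable.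
by apply/seteqP; split=> w /= /RIC_L_leP; exact.
Qed.

End measurability.

(** * Failure probability on the net *)
Section union_bound.
Context {R : realType} {d : measure_display} {T : measurableType d} (P : probability T R).

Lemma finite_union_bound (I : finType) (A : I -> set T) (E : set T) :
  (forall i, measurable (A i)) -> measurable E ->
  (forall w, E w -> exists i, A i w) -> (P E <= \sum_i P (A i))%E.
Proof.
move=> mA mE EA; rewrite (@bigfs _ _ _ _ _ predT _ (index_enum_uniq I)); last first.
  by move=> i _; rewrite mem_index_enum.
rewrite (_ : [set` _] = setT); last by apply/seteqP; split.
apply: content_sub_fsum => //; first exact: finite_finset.
by move=> w /EA[i Ai]; exists i.
Qed.

Context (n N : nat) (X : 'I_n -> 'I_N -> {RV P >-> R}).

(** The factors count the supports, the codes for a given support, and the two tails.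
The codes are indexed together with their support and sign, and the events of
unwanted indices are made empty, so that the union ranges over a finite type. *)
Lemma lattice_net_failure (m k : nat) (y : R) (E : set T) :
  gaussian_matrix X -> (0 < n)%N -> (0 < m)%N -> (0 < k)%N ->
  0 <= y <= 1/10 -> measurable E ->
  (forall w, ~ E w -> exists S : {set 'I_N}, exists f,
     [/\ #|S| = k, f \in lattice_net m k S &
         y <= `|distortion (random_matrix X w) (lattice_point f)|]) ->
  (1 - P E <= ('C(N, k)%:R * (4 * 2 ^+ (m ^ 2)) ^+ k *
    (2 * expR (- (5/22 * y ^+ 2 * n%:R))))%:E)%E.
Proof.
move=> XG n0 m0 k0 y01 mE hE.
rewrite -probability_setC//.
set e := expR _.
pose I := ({set 'I_N} * {ffun 'I_N -> coord_code m k} * bool)%type.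
pose good (i : I) := (#|i.1.1| == k) && (i.1.2 \in lattice_net m k i.1.1).
pose A (i : I) : set T := if good i then
  [set w | y <= (-1) ^+ i.2 *
    distortion (random_matrix X w) (lattice_point i.1.2)] else set0.
have mA i : measurable (A i).
  by rewrite /A; case: ifP => // _; exact: measurable_distortion_ge.
apply: (le_trans (finite_union_bound mA (measurableC mE) _)).
  move=> w /hE [S [f [Sk fS yf]]].
  exists (S, f, distortion (random_matrix X w) (lattice_point f) < 0).
  rewrite /A /good /= Sk eqxx fS /=; apply: (le_trans yf).
  by rewrite -normrEsign ?num_real.
apply: (@le_trans _ _ (\sum_(i : I) ((good i)%:R * e)%:E)%E).
  apply: lee_sum => i _; rewrite /A; case: ifP => [gi|_]; last first.
    by rewrite measure0 lee_fin mulr_ge0// expR_ge0.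
  rewrite mul1r; move: gi => /andP[/eqP Sk fS].
  by apply: distortion_tail => //; rewrite ?sqrr_sign// (sqnorm_lattice_point_le1 m0 k0 fS).
rewrite sumEFin lee_fin -mulr_suml [leRHS]mulrA ler_wpM2r ?expR_ge0//.
rewrite -(pair_bigA _ (fun p b => (good (p, b))%:R))/=.
under eq_bigr do rewrite big_bool/= /good/=.
rewrite -(pair_bigA _ (fun (S : {set 'I_N}) (f : {ffun 'I_N -> coord_code m k}) =>
  ((#|S| == k) && (f \in lattice_net m k S))%:R +
  ((#|S| == k) && (f \in lattice_net m k S))%:R))/=.
have -> : 'C(N, k) = #|[set S : {set 'I_N} | #|S| == k]%SET|.
  by rewrite card_draws card_ord.
rewrite -sum1_card natr_sum mulr_suml mulr_suml.
rewrite [leRHS]big_mkcond/=; apply: ler_sum => S _.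
rewrite inE; case: eqP => /= [Sk|_]; last by rewrite big1// => f _; rewrite addr0.
have := card_lattice_net m Sk (R := R).
rewrite -sum1_card natr_sum [in X in X -> _]big_mkcond/= => le.
rewrite mul1r big_split/=.
have : \sum_f (f \in lattice_net m k S)%:R <= (4 * 2 ^+ (m ^ 2)) ^+ k :> R.
  apply: le_trans le; apply: ler_sum => f _; by case: ifP.
lra.
Qed.

End union_bound.

(** * Asymptotics *)
Section asymptotics.
Context {R : realType}.

(** From 'C(N, k) k! <= N^k and k^k / k! <= exp k, the latter being one term of the
exponential series. *)
Lemma bin_le_expR (N k : nat) : (0 < k <= N)%N ->
  ('C(N, k)%:R : R) <= expR (k%:R * (1 + ln (N%:R / k%:R))).
Proof.
move=> /andP[k0 kN].
have N0 : (0 < N)%N := leq_trans k0 kN.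
have kR : (0 : R) < k%:R by rewrite ltr0n.
have NR : (0 : R) < N%:R by rewrite ltr0n.
have fR : (0 : R) < (k`!)%:R by rewrite ltr0n fact_gt0.
rewrite expRM_natl expRD lnK ?posrE ?divr_gt0// exprMn expr_div_n.
rewrite -expRM_natr mul1r mulrA ler_pdivlMr ?exprn_gt0//.
have e1 : (k%:R ^+ k : R) <= expR k%:R * (k`!)%:R.
  rewrite -ler_pdivrMr//; apply: le_trans (_ : 1 + k%:R ^+ k / (k`!)%:R <= _).
    by rewrite lerDr.
  by case: k k0 kR {kN fR} => // k _ kR; apply: expR_ge1Dxn; exact: ltW.
have e2 : ('C(N, k)%:R * (k`!)%:R : R) <= N%:R ^+ k.
  rewrite -natrM bin_ffact -natrX ler_nat.
  elim: k {k0 kN kR fR e1} => [|k IH]; first by rewrite ffactn0.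
  by rewrite ffactnSr expnSr leq_mul// leq_subr.
apply: le_trans (ler_wpM2l (ler0n _ _) e1) _.
by rewrite mulrCA ler_wpM2l ?expR_ge0.
Qed.

(** The finitely many initial terms are absorbed in the constant. *)
Lemma tends_to_1_exponentially_eventually (k : nat -> nat) (p : nat -> \bar R)
    (C alpha : R) : 0 < alpha ->
  (forall t, 1 - p t <= 1)%E ->
  (\forall t \near \oo, (1 - p t <= (C * expR (- (alpha * (k t)%:R)))%:E)%E) ->
  tends_to_1_exponentially k p.
Proof.
move=> a0 p1 [t0 _ ht0].
exists (`|C| + \sum_(i < t0) expR (alpha * (k i)%:R)), alpha; split=> // t.
have S0 : 0 <= \sum_(i < t0) expR (alpha * (k i)%:R).
  by apply: sumr_ge0 => i _; exact: expR_ge0.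
have [t0t|tt0] := leqP t0 t.
  apply: (le_trans (ht0 t t0t)); rewrite lee_fin ler_wpM2r ?expR_ge0//.
  by rewrite (le_trans (ler_norm C))// lerDl.
apply: (le_trans (p1 t)); rewrite lee_fin.
rewrite -[leLHS](expRxMexpNx_1 (alpha * (k t)%:R)) ler_wpM2r ?expR_ge0//.
rewrite (bigD1 (Ordinal tt0))//= addrCA lerDl addr_ge0 ?normr_ge0//.
by apply: sumr_ge0 => i _; exact: expR_ge0.
Qed.

(** Here [a] stands for ln (1/delta) and [K] for the logarithm of the number of net
vectors per coordinate.  Put b = ln (1/rho).  The first estimate, which makes the
deviations at most 1/10, follows from rho = exp(- b) <= 2 / b^2.  In the second, the
coefficient of b is 1 on the left and (5/22) (9/10)^2 6 > 1.1 on the right. *)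
Lemma small_rho_bounds (K c a : R) : 0 <= K -> 0 <= c -> 0 <= a ->
  exists2 rho0 : R, 0 < rho0 & forall rho, 0 < rho < rho0 ->
    [/\ ln rho <= 0, rho * (4 * a - 6 * ln rho + c) <= 1 / 100 &
        1 + K + a - ln rho < 5/22 * (9/10) ^+ 2 * (4 * a - 6 * ln rho + c)].
Proof.
move=> K0 c0 a0.
pose B := 1400 + 10 * (1 + K + a) + 4 * a + c.
exists (expR (- B)); first exact: expR_gt0.
move=> rho /andP[r0 rB].
pose b := - ln rho.
have Bb : B < b.
  by rewrite /b ltrNr -ltr_expR lnK.
have -> : ln rho = - b by rewrite /b opprK.
have rhoE : rho = expR (- b) by rewrite /b opprK lnK.
have b0 : 0 < b by move: Bb; rewrite /B; lra.
split; [by rewrite oppr_le0 ltW| |by move: Bb; rewrite /B; lra].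
have eb : b ^+ 2 / 2 <= expR b.
  have := @expR_ge1Dxn R b 1 (ltW b0); rewrite (_ : (2`!)%:R = 2 :> R)//; lra.
rewrite rhoE expRN mulrC ler_pdivrMr ?expR_gt0//.
apply: le_trans (_ : 1/100 * (b ^+ 2 / 2) <= _); last by rewrite ler_wpM2l// divr_ge0.
have Bb2 : 1400 * b <= b ^+ 2.
  by rewrite expr2 ler_wpM2r ?(ltW b0)//; move: Bb; rewrite /B; lra.
by move: Bb; rewrite /B; lra.
Qed.


Lemma RIC_failure (m k n N : nat) (x a : R) (d : measure_display)
    (T : measurableType d) (P : probability T R) (X : 'I_n -> 'I_N -> {RV P >-> R}) :
  gaussian_matrix X -> (2 < m)%N -> (0 < k)%N -> (k <= n)%N -> (n <= N)%N ->
  0 <= x <= 1/10 -> x <= a ->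
  let fail := (2 * expR (k%:R * (1 + ln (4 * 2 ^+ (m ^ 2)) + ln (N%:R / k%:R)
    - 5/22 * ((1 - 2 / m%:R) * x) ^+ 2 * (n%:R / k%:R))))%:E in
  (1 - P [set w | (RIC_L k (random_matrix X w) < a)%R] <= fail)%E /\
  (1 - P [set w | (RIC_U k (random_matrix X w) < a)%R] <= fail)%E.
Proof.
move=> XG m2 k0 kn nN /andP[x0 x1] xa fail.
have n0 : (0 < n)%N := leq_trans k0 kn.
have N0 : (0 < N)%N := leq_trans n0 nN.
have kN : (k <= N)%N := leq_trans kn nN.
have kkN : (0 < k <= N)%N by rewrite k0.
have m0 : (0 < m)%N by apply: ltn_trans m2.
have mR : (0 : R) < m%:R by rewrite ltr0n.
have kR : (0 : R) < k%:R by rewrite ltr0n.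
have pos : 0 < 1 - 2 / m%:R :> R by rewrite subr_gt0 ltr_pdivrMr// mul1r ltr_nat.
pose y := (1 - 2 / m%:R) * x.
have y01 : 0 <= y <= 1 / 10.
  apply/andP; split; first by rewrite mulr_ge0// ltW.
  apply: le_trans x1; rewrite ler_piMl// lerBlDr lerDl divr_ge0// ltW//.
have yx : y / (1 - 2 / m%:R) = x by rewrite /y mulrC mulKf// gt_eqF.
have bound (E : set T) : measurable E ->
    (forall w, (forall S : {set 'I_N}, #|S| = k -> forall f, f \in lattice_net m k S ->
       `|distortion (random_matrix X w) (lattice_point f)| < y) -> E w) ->
    (1 - P E <= fail)%E.
  move=> mE hE; apply: (le_trans (lattice_net_failure XG n0 m0 k0 y01 mE _)).
    move=> w Ew; apply: contrapT => none; apply: Ew; apply: hE => S Sk f fS.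
    by rewrite ltNge; apply/negP => yf; apply: none; exists S, f.
  rewrite lee_fin mulrCA ler_wpM2l//.
  have -> : (4 * 2 ^+ (m ^ 2)) ^+ k = expR (k%:R * ln (4 * 2 ^+ (m ^ 2))) :> R.
    by rewrite expRM_natl lnK// posrE mulr_gt0// exprn_gt0.
  apply: (le_trans (ler_wpM2r (expR_ge0 _) (ler_wpM2r (expR_ge0 _) (bin_le_expR _)))).
    by rewrite k0.
  rewrite -!expRD ler_expR le_eqVlt; apply/orP; left; apply/eqP; rewrite -/y.
  by field; rewrite gt_eqF.
split; apply: bound.
- exact: measurable_RIC_L_lt.
- move=> w hw; have [+ _] := RIC_le_lattice_net m2 kkN hw.
  by rewrite yx => /lt_le_trans; apply.
- exact: measurable_RIC_U_lt.
- move=> w hw; have [_ +] := RIC_le_lattice_net m2 kkN hw.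
  by rewrite yx => /lt_le_trans; apply.
Qed.

End asymptotics.


Theorem theorem2 (R : realType) (eps c : R) (heps : 0 < eps) (hc : 6 < c)
    (delta : R) (hdelta : 0 < delta < 1) :
  exists2 rho0 : R, 0 < rho0 &
  forall (rho : R), 0 < rho < rho0 ->
  forall (k n N : nat -> nat),
    (forall t, (0 < k t)%N /\ (k t <= n t)%N /\ (n t <= N t)%N) ->
    k @ \oo --> \oo ->
    (fun t => (n t)%:R / (N t)%:R : R) @ \oo --> delta ->
    (fun t => (k t)%:R / (n t)%:R : R) @ \oo --> rho ->
    (fun t => ln (n t)%:R / (k t)%:R : R) @ \oo --> (0 : R) ->
  forall (d : nat -> measure_display) (T : forall t, measurableType (d t))
    (P : forall t, probability (T t) R)
    (X : forall t, 'I_(n t) -> 'I_(N t) -> {RV (P t) >-> R}),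
    (forall t, gaussian_matrix (X t)) ->
    tends_to_1_exponentially k (fun t => P t
      [set w | RIC_L (k t) (random_matrix (X t) w)
               < (1 + eps) * Ltilde c delta rho]) /\
    tends_to_1_exponentially k (fun t => P t
      [set w | RIC_U (k t) (random_matrix (X t) w)
               < (1 + eps) * Utilde c delta rho]).
Proof.
have /andP[d0 d1] := hdelta.
(* Since [1 - 2 / 20 = 9 / 10], the coefficient of ln (1/rho) in the exponent is
   negative; the value of [m] is then forgotten, so that [2 ^+ (m ^ 2)] is never
   expanded. *)
pose m := 20%N; have m2 : (2 < m)%N by [].
have m9 : 1 - 2 / m%:R = 9/10 :> R by rewrite /m; lra.
move: m m2 m9 => m m2 m9.
pose K := ln (4 * 2 ^+ (m ^ 2)) : R.
have K0 : 0 <= K.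
  by rewrite ln_ge0// (le_trans (_ : 1 <= 4 :> R))// ?ler_peMr// ?exprn_ege1// ler1n.
have a0 : 0 <= - ln delta by rewrite oppr_ge0 ln_le0// ltW.
have c0 : 0 <= c by lra.
have [rho0 rho00 hrho] := small_rho_bounds K0 c0 a0.
exists rho0 => // rho hr k n N hkn kinf nN kn _ d T P X XG.
have /andP[r0 _] := hr.
have [lr0 small big] := hrho _ hr.
pose Q := 4 * - ln delta - 6 * ln rho + c.
have Q0 : 0 <= Q by rewrite /Q; lra.
have tildeE : 2 * rho * ln (1 / (delta ^+ 2 * rho ^+ 3)) + c * rho = rho * Q.
  rewrite div1r lnV ?posrE ?mulr_gt0 ?exprn_gt0// lnM ?posrE ?exprn_gt0//.
  by rewrite !lnXn// /Q; ring.
pose x := Num.sqrt (rho * Q).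
have x2 : x ^+ 2 = rho * Q by rewrite sqr_sqrtr// mulr_ge0// ltW.
have x0 : 0 <= x := sqrtr_ge0 _.
have x1 : x <= 1/10.
  rewrite -(@ler_pXn2r _ 2)// ?nnegrE ?divr_ge0// x2; apply: (le_trans small); lra.
have xa : x <= (1 + eps) * x by rewrite ler_peMl// lerDl ltW.
rewrite /Ltilde /Utilde tildeE -/x.
(* [g t] is the exponent per unit of [k t], and [G] its limit. *)
pose g t := 1 + K + ln ((N t)%:R / (k t)%:R) -
  5/22 * ((1 - 2 / m%:R) * x) ^+ 2 * ((n t)%:R / (k t)%:R).
pose G := 1 + K + ln ((delta * rho)^-1) - 5/22 * ((1 - 2 / m%:R) * x) ^+ 2 * rho^-1.
have kR t : (0 : R) < (k t)%:R by rewrite ltr0n; case: (hkn t).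
have nR t : (0 : R) < (n t)%:R.
  by rewrite ltr0n; have [k0 [h _]] := hkn t; exact: leq_trans h.
have NR t : (0 : R) < (N t)%:R.
  by rewrite ltr0n; have [k0 [h h']] := hkn t; exact: leq_trans (leq_trans h h').
have gG : g @ \oo --> G.
  have rV : (fun t => (n t)%:R / (k t)%:R : R) @ \oo --> rho^-1.
    rewrite (_ : (fun t => _) = fun t => ((k t)%:R / (n t)%:R)^-1); last first.
      by apply/funext => t; rewrite invf_div.
    by apply: cvgV => //; rewrite gt_eqF.
  have drV : (fun t => (N t)%:R / (k t)%:R : R) @ \oo --> (delta * rho)^-1.
    rewrite (_ : (fun t => _) =
        fun t => ((n t)%:R / (N t)%:R * ((k t)%:R / (n t)%:R))^-1); last first.
      by apply/funext => t; field; rewrite !gt_eqF.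
    by apply: cvgV; [rewrite gt_eqF// mulr_gt0|exact: cvgM].
  apply: cvgB; last by apply: cvgM => //; exact: cvg_cst.
  apply: cvgD; first exact: cvg_cst.
  apply: continuous_cvg => //; apply: continuous_ln.
  by rewrite invr_gt0 mulr_gt0.
have G0 : G < 0.
  have -> : G = 1 + K - ln delta - ln rho - 5/22 * (9/10) ^+ 2 * Q.
    rewrite /G m9 exprMn x2 lnV ?posrE ?mulr_gt0// lnM ?posrE//.
    by field; rewrite gt_eqF.
  by rewrite /Q; lra.
have evg : \forall t \near \oo, g t < G / 2.
  by apply: (cvgr_lt G gG); lra.
have fail t := RIC_failure (XG t) m2 (hkn t).1 (hkn t).2.1 (hkn t).2.2
  (introT andP (conj x0 x1)) xa.
have a1 : 0 < - G / 2 by lra.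
have le1 t (E : set (T t)) : (1 - P t E <= 1)%E.
  by rewrite -[leRHS]adde0 leeD2l// oppe_le0 measure_ge0.
have bound t : g t < G / 2 ->
    2 * expR ((k t)%:R * g t) <= 2 * expR (- (- G / 2 * (k t)%:R)).
  move=> gt; rewrite ler_wpM2l// ler_expR mulrC -mulNr ler_wpM2r ?(ltW (kR t))//; lra.
split; apply: (tends_to_1_exponentially_eventually (C := 2) a1) => [t|].
- exact: le1.
- apply: filterS evg => t gt; apply: (le_trans (fail t).1).
  by rewrite lee_fin; exact: bound.
- exact: le1.
- apply: filterS evg => t gt; apply: (le_trans (fail t).2).
  by rewrite lee_fin; exact: bound.
Qed.
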